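(* Let $H$ be a complex Hilbert space, $\lambda\in[0,1]$ and $T\in\mathcal{B}(H)$. Then for each natural number $n$, the following limits exist and $$r(T)=\lim_{k\to\infty}\|\Delta_\lambda^n(T^k)\|^{1/k}=\lim_{k\to\infty}\|\Delta_\lambda(T^k)\|^{1/k}.$$
   Context: $H$ is a (nonzero) complex Hilbert space, $\mathcal{B}(H)$ is the space of bounded linear operators on $H$ with the operator norm $\|\cdot\|$, and $r(T)$ is the spectral radius of $T$. For $T\in\mathcal{B}(H)$, $|T|=(T^*T)^{1/2}$ and $T=U|T|$ is the unique polar decomposition, with $U$ the partial isometry satisfying $\ker U=\ker T$. For $\lambda\in[0,1]$ the $\lambda$-Aluthge transform is $\Delta_\lambda(T)=|T|^{\lambda}U|T|^{1-\lambda}$, with the convention $|T|^0=I$, so that $\Delta_0(T)=U|T|=T$ and $\Delta_1(T)=|T|U$. Its iterates are $\Delta_\lambda^0(T)=T$ and $\Delta_\lambda^{n+1}(T)=\Delta_\lambda(\Delta_\lambda^n(T))$. Natural numbers include $0$. *)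

(* Defs.v *)
From HB Require Import structures.
From mathcomp Require Import all_boot all_order all_algebra.
From mathcomp Require Export complex.
From mathcomp Require Import all_classical all_reals all_analysis.
Import Order.TTheory GRing.Theory Num.Theory.
Import numFieldNormedType.Exports.

Set Implicit Arguments.
Unset Strict Implicit.
Unset Printing Implicit Defensive.

Local Open Scope classical_set_scope.
Local Open Scope ring_scope.
Local Open Scope complex_scope.

(* A complex Hilbert space is a Banach space over R[i] whose norm comes from
   an inner product, linear in the first variable; R is the field of reals. *)
HB.mixin Record CompleteNormedModule_isHilbert (R : realType) H
    & CompleteNormedModule R[i] H := {
  inner : {dot H for @conjc R};
  inner_normE : forall x : H, `|x| ^+ 2 = inner x x
}.

#[short(type="hilbertType")]
HB.structure Definition Hilbert (R : realType) :=
  {H of CompleteNormedModule_isHilbert R H & CompleteNormedModule R[i] H}.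

Notation "'[ x , y ]" := (inner x y) : ring_scope.

(* Norms over R[i] are R[i]-valued; this is the same number as a real. *)
Definition rnorm (R : realType) (V : normedZmodType R[i]) (x : V) : R :=
  complex.Re `|x|.

Section BoundedOperators.
Variables (R : realType) (H : hilbertType R).

(* For linear maps between normed spaces, bounded and continuous agree
   (linear_bounded_continuous). *)
Definition bounded_operator : {pred (H -> H)} :=
  [pred f : H -> H | `[< linear f /\ continuous f >]].

Record bop := Bop { bop_fun :> H -> H ; _ : bop_fun \in bounded_operator }.

HB.instance Definition _ := [isSub for bop_fun].
HB.instance Definition _ := [Choice of bop by <:].

Lemma bopP (f : H -> H) :
  reflect (linear f /\ continuous f) (f \in bounded_operator).
Proof. exact: asboolP. Qed.

Lemma bop_linear (T : bop) : linear T.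
Proof. by case: T => f /= /bopP[]. Qed.

Lemma bop_continuous (T : bop) : continuous T.
Proof. by case: T => f /= /bopP[]. Qed.

HB.instance Definition _ (T : bop) :=
  GRing.isLinear.Build R[i] H H *:%R (bop_fun T) (@bop_linear T).

Fact bounded_operator_submod_closed : submod_closed bounded_operator.
Proof.
split; first by apply/bopP; split;
  [move=> a x y; rewrite /= scaler0 addr0 | exact: cst_continuous].
move=> a f g /bopP[lf cf] /bopP[lg cg]; apply/bopP; split.
  move=> b x y; rewrite !fctE lf lg !scalerDr !scalerA (mulrC a b).
  by rewrite addrACA.
move=> x; apply: cvgD; last exact: cg.
by apply: cvgZl_tmp; exact: cf.
Qed.

HB.instance Definition _ :=
  GRing.isSubmodClosed.Build R[i] (H -> H) bounded_operator
    bounded_operator_submod_closed.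
HB.instance Definition _ := [SubChoice_isSubLmodule of bop by <:].

Fact bop1_subproof : idfun \in bounded_operator.
Proof. by apply/bopP; split=> // x. Qed.
Definition bop1 : bop := Bop bop1_subproof.

Fact bopM_subproof (S T : bop) : S \o T \in bounded_operator.
Proof.
apply/bopP; split; first by move=> a x y; rewrite /= !linearP.
by move=> x; apply: continuous_comp; exact: bop_continuous.
Qed.
Definition bopM (S T : bop) : bop := Bop (bopM_subproof S T).

Fact bopMA : associative bopM. Proof. by move=> S T U; exact/val_inj. Qed.
Fact bop1M : left_id bop1 bopM. Proof. by move=> T; exact/val_inj. Qed.
Fact bopM1 : right_id bop1 bopM. Proof. by move=> T; exact/val_inj. Qed.
Fact bopMDl : left_distributive bopM +%R.
Proof. by move=> S T U; exact/val_inj. Qed.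
Fact bopMDr : right_distributive bopM +%R.
Proof. by move=> S T U; apply/val_inj/funext => x /=; rewrite linearD. Qed.

HB.instance Definition _ :=
  GRing.Zmodule_isPzRing.Build bop bopMA bop1M bopM1 bopMDl bopMDr.

Definition opnorm (T : bop) : R :=
  sup [set rnorm (T x) | x in [set x | rnorm x <= 1]].

Definition invertible (T : bop) : Prop :=
  exists S : bop, S * T = 1 /\ T * S = 1.

Definition spectrum (T : bop) : set R[i] :=
  [set z | ~ invertible (T - z *: (1 : bop))].

Definition spectral_radius (T : bop) : R := sup [set rnorm z | z in spectrum T].

(* In adjoint, oppow and polar_isometry, xget selects the only element of the
   set; its default value 0 is never used on the operators of interest. *)
Definition adjoint (T : bop) : bop :=
  xget 0 [set S : bop | forall x y, '[T x, y] = '[x, S y]].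

Definition op_horner (p : {poly R}) (A : bop) : bop :=
  \sum_(i < size p) (p`_i)%:C *: A ^+ i.

(* Continuous functional calculus of a self-adjoint A (whose spectrum is
   real): B = f(A) is the norm limit of p_n(A), for polynomials p_n converging
   to f uniformly on the spectrum of A. *)
Definition is_cfc (A : bop) (f : R -> R) (B : bop) : Prop :=
  exists p : nat -> {poly R},
    (forall e : R, 0 < e -> \forall n \near \oo,
       forall t : R, spectrum A t%:C -> `|(p n).[t] - f t| <= e) /\
    opnorm (op_horner (p n) A - B) @[n --> \oo] --> (0 : R).

(* A^s for A >= 0 and s >= 0; since 0 `^ 0 = 1, A^0 = I. *)
Definition oppow (A : bop) (s : R) : bop :=
  xget 0 [set B | is_cfc A (fun t => t `^ s) B].

Definition opabs (T : bop) : bop := oppow (adjoint T * T) 2^-1.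

Definition partial_isometry (U : bop) : Prop :=
  forall x, (forall y, U y = 0 -> '[x, y] = 0) -> `|U x| = `|x|.

Definition polar_isometry (T : bop) : bop :=
  xget 0 [set U | [/\ partial_isometry U,
                      forall x, U x = 0 <-> T x = 0 & T = U * opabs T]].

Definition aluthge (lambda : R) (T : bop) : bop :=
  oppow (opabs T) lambda * polar_isometry T * oppow (opabs T) (1 - lambda).

End BoundedOperators.

(* Main.v *)
Require Import Defs.
From HB Require Import structures.
From mathcomp Require Import all_boot all_order all_algebra.
From mathcomp Require Import all_classical all_reals all_analysis.
From mathcomp Require Import ring lra.
Import Order.TTheory GRing.Theory Num.Theory.
Import numFieldNormedType.Exports.

Set Implicit Arguments.
Unset Strict Implicit.
Unset Printing Implicit Defensive.

Local Open Scope classical_set_scope.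
Local Open Scope ring_scope.
Local Open Scope complex_scope.

(** Let r denote the growth rate lim |T^k|^(1/k).  Writing T = U|T|, the operator
    T = (U|T|^(1-l)) |T|^l and its transform |T|^l (U|T|^(1-l)) are of the form AB
    and BA, so they have the same growth rate, while |Delta_l(T)| <= |T|.  Hence
    r(T)^k <= r(T^k) <= |Delta_l^n(T^k)| <= |T^k|, and k-th roots converge to r(T).

    The growth rate is the spectral radius by Rickart's argument: if the spectrum
    lay strictly inside the circle of radius r > 0, then (1 - wT)^-1 would be
    Lipschitz on the disk |w| <= 1/r, and so would (1 - (wT)^n)^-1, n = 2^k, with
    the same constant, as an average of resolvents over roots of unity.  As
    (twT)^n -> 0 for t < 1, this would force (wT)^n to be small at w = 1/r, against
    |T^n| >= r^n.

    Powers of |T| exist because Bernstein polynomials approximate t^s uniformly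
    on [0, M], and |p(A)| is the maximum of |p| over the spectrum of a self-adjoint
    A, its growth rate being its norm. *)

(** * Norms and inner products *)

(** The spectrum matters twice: in identifying the limit, and in the functional calculus, where
    values on the spectrum of a self-adjoint operator must control norms. Both rest on one fact,
    that the spectrum is non-empty and reaches the circle whose radius is the growth rate; it is
    obtained from compactness of a disk and a Lipschitz bound, without holomorphy. This is where [H]
    must be non-zero: on the zero space 1 has norm 0 and no spectrum. Upper bounds on the spectrum,
    its reality and its positivity come from coercivity, hence the early place of projections and
    Riesz representation. Operators chosen by [xget] each need an existence proof; for powers
    uniqueness is needed too, since [|T|^l |T|^(1-l) = |T|] compares separately chosen limits. The
    obstacle to polynomial approximation is that [t^s] is not Lipschitz at 0; Bernstein's method
    needs only a quadratic majorant of the increments, which Holder continuity supplies. *)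

Section RealComplex.
Variable R : realType.
Implicit Types (s t : R).

Lemma realcD s t : (s + t)%:C = s%:C + t%:C.
Proof. exact: rmorphD. Qed.

Lemma realcM s t : (s * t)%:C = s%:C * t%:C.
Proof. exact: rmorphM. Qed.

Lemma realcX t n : (t ^+ n)%:C = t%:C ^+ n.
Proof. exact: rmorphXn. Qed.

Lemma conjcM (a b : R[i]) : conjc (a * b) = conjc a * conjc b.
Proof. exact: rmorphM. Qed.

End RealComplex.

Section RealNorm.
Variables (R : realType) (V : normedZmodType R[i]).
Implicit Types (x y : V).

Lemma rnormE x : `|x| = (rnorm x)%:C.
Proof. by rewrite /rnorm RRe_real// normr_real. Qed.

Lemma rnorm_ge0 x : 0 <= rnorm x.
Proof. by rewrite -ler0c -rnormE. Qed.

Lemma rnorm0 : rnorm (0 : V) = 0.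
Proof. by apply: complexI; rewrite -rnormE normr0. Qed.

Lemma rnorm_eq0 x : (rnorm x == 0) = (x == 0).
Proof. by rewrite -[RHS]normr_eq0 rnormE eq_complex /= eqxx andbT. Qed.

Lemma rnormN x : rnorm (- x) = rnorm x.
Proof. by rewrite /rnorm normrN. Qed.

Lemma rnormBC x y : rnorm (x - y) = rnorm (y - x).
Proof. by rewrite /rnorm distrC. Qed.

Lemma rnormD x y : rnorm (x + y) <= rnorm x + rnorm y.
Proof. by rewrite -lecR realcD -!rnormE ler_normD. Qed.

Lemma rnormB x y : rnorm (x - y) <= rnorm x + rnorm y.
Proof. by rewrite -(rnormN y) rnormD. Qed.

Lemma rnorm_triangle x y z : rnorm (x - z) <= rnorm (x - y) + rnorm (y - z).
Proof. by rewrite (_ : x - z = (x - y) + (y - z)) ?rnormD// addrA subrK. Qed.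

Lemma rnorm_eps x : (forall e : R, 0 < e -> rnorm x <= e) -> x = 0.
Proof.
move=> h; apply/eqP; rewrite -rnorm_eq0 eq_le rnorm_ge0 andbT.
by apply/ler_addgt0Pr => e e0; rewrite add0r h.
Qed.

End RealNorm.

Lemma rnormZ (R : realType) (V : normedModType R[i]) (a : R[i]) (x : V) :
  rnorm (a *: x) = rnorm a * rnorm x.
Proof. by apply: complexI; rewrite realcM -!rnormE normrZ. Qed.

Section ComplexNorm.
Variable R : realType.
Implicit Types (a b : R[i]).

Lemma rnormM a b : rnorm (a * b) = rnorm a * rnorm b.
Proof. by apply: complexI; rewrite realcM -!rnormE normrM. Qed.

Lemma rnormX a n : rnorm (a ^+ n) = rnorm a ^+ n.
Proof. by apply: complexI; rewrite realcX -!rnormE normrX. Qed.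

Lemma rnormC (t : R) : rnorm t%:C = `|t|.
Proof.
by rewrite /rnorm normc_def /= expr0n addr0 sqrtr_sqr.
Qed.

Lemma rnorm1 : rnorm (1 : R[i]) = 1.
Proof. by rewrite -[1](rmorph1 (real_complex R)) rnormC normr1. Qed.

Lemma rnormV a : rnorm a^-1 = (rnorm a)^-1.
Proof. by apply: complexI; rewrite fmorphV /= -!rnormE normfV. Qed.

Lemma rnorm_Re a : `|complex.Re a| <= rnorm a.
Proof. by rewrite -lecR -rnormE normc_ge_Re. Qed.

Lemma rnorm_Im a : `|complex.Im a| <= rnorm a.
Proof.
rewrite /rnorm normc_def /= -[leLHS]sqrtr_sqr ler_sqrt ?addr_ge0 ?sqr_ge0//.
by rewrite lerDr sqr_ge0.
Qed.

Lemma Re_subM a b (t : R) :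
  complex.Re (a - b * t%:C) = complex.Re a - complex.Re b * t.
Proof. by case: a b => [u v] [p q] /=; ring. Qed.

Lemma Im_subM a b (t : R) :
  complex.Im (a - b * t%:C) = complex.Im a - complex.Im b * t.
Proof. by case: a b => [u v] [p q] /=; ring. Qed.

End ComplexNorm.

Section Inner.
Variables (R : realType) (H : hilbertType R).
Implicit Types (x y z : H) (a : R[i]).

Lemma innerC x y : '[x, y] = conjc '[y, x].
Proof. by rewrite hermC /= expr0 mul1r. Qed.

Lemma inner_rnorm x : '[x, x] = (rnorm x ^+ 2)%:C.
Proof. by rewrite -inner_normE rnormE realcX. Qed.

Lemma innerDl x y z : '[x + y, z] = '[x, z] + '[y, z].
Proof. exact: linearDl. Qed.
Lemma innerDr x y z : '[z, x + y] = '[z, x] + '[z, y].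
Proof. exact: linearDr. Qed.
Lemma innerBl x y z : '[x - y, z] = '[x, z] - '[y, z].
Proof. exact: linearBl. Qed.
Lemma innerBr x y z : '[z, x - y] = '[z, x] - '[z, y].
Proof. exact: linearBr. Qed.
Lemma innerZl a x y : '[a *: x, y] = a * '[x, y].
Proof. exact: linearZl_LR. Qed.
Lemma innerZr a x y : '[x, a *: y] = conjc a * '[x, y].
Proof. exact: linearZr_LR. Qed.
Lemma inner0l x : '[0, x] = 0.
Proof. exact: linear0l. Qed.
Lemma inner0r x : '[x, 0] = 0.
Proof. exact: linear0r. Qed.

Lemma inner_ReC x y : complex.Re '[x, y] = complex.Re '[y, x].
Proof. by rewrite innerC; case: '[y, x]. Qed.

Lemma innerC_eq0 x y : '[x, y] = 0 -> '[y, x] = 0.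
Proof. by move=> h; rewrite innerC h conjc0. Qed.

Lemma inner_eq0 x : '[x, x] = 0 -> x = 0.
Proof.
rewrite inner_rnorm => /eqP; rewrite eq_complex /= eqxx andbT.
by rewrite sqrf_eq0 rnorm_eq0 => /eqP.
Qed.

Lemma rnorm_sqr x : rnorm x ^+ 2 = complex.Re '[x, x].
Proof. by rewrite inner_rnorm. Qed.

Lemma rnorm_sqrD x y :
  rnorm (x + y) ^+ 2 = rnorm x ^+ 2 + rnorm y ^+ 2 + 2 * complex.Re '[x, y].
Proof.
rewrite !rnorm_sqr innerDl !innerDr (innerC y x) !raddfD /=.
by case: '[x, y] => u v /=; ring.
Qed.

Lemma rnorm_sqrB x y :
  rnorm (x - y) ^+ 2 = rnorm x ^+ 2 + rnorm y ^+ 2 - 2 * complex.Re '[x, y].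
Proof.
rewrite rnorm_sqrD rnormN -scaleN1r innerZr rmorphN rmorph1 mulN1r.
by case: '[x, y] => u v /=; ring.
Qed.

Lemma pythagoras x y : '[x, y] = 0 ->
  rnorm (x + y) ^+ 2 = rnorm x ^+ 2 + rnorm y ^+ 2.
Proof. by move=> h; rewrite rnorm_sqrD h mulr0 addr0. Qed.

Lemma rnorm_le_pythagoras x y : '[x, y] = 0 -> rnorm x <= rnorm (x + y).
Proof.
move=> /pythagoras h; rewrite -(ler_pXn2r (n := 2)) ?nnegrE ?rnorm_ge0//.
by rewrite h lerDl sqr_ge0.
Qed.

(** [a *: y] is the orthogonal projection of [x] on the line of [y], so by Pythagoras it is no
    longer than [x]. *)
Lemma cauchy_schwarz x y : rnorm '[x, y] <= rnorm x * rnorm y.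
Proof.
have [->|y0] := eqVneq y 0; first by rewrite inner0r !rnorm0 mulr0.
have ny : 0 < rnorm y by rewrite lt_def rnorm_ge0 rnorm_eq0 y0.
pose a := '[x, y] / '[y, y].
have yy0 : '[y, y] != 0.
  by rewrite inner_rnorm eq_complex /= eqxx andbT sqrf_eq0 gt_eqF.
have h : '[x - a *: y, a *: y] = 0.
  by rewrite innerZr innerBl innerZl /a divfK// subrr mulr0.
have := pythagoras h; rewrite subrK rnormZ => e.
have : rnorm a * rnorm y <= rnorm x.
  rewrite -(ler_pXn2r (n := 2)) ?nnegrE ?mulr_ge0 ?rnorm_ge0//.
  by rewrite e lerDr sqr_ge0.
rewrite /a rnormM rnormV inner_rnorm rnormC ger0_norm ?sqr_ge0//.
rewrite expr2 invfM -!mulrA mulVf ?gt_eqF// mulr1.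
by rewrite ler_pdivrMr.
Qed.

End Inner.

(** * Orthogonal projection *)

Lemma invS_le (R : realType) (e : R) : 0 < e ->
  exists N : nat, forall n, (N <= n)%N -> n.+1%:R^-1 <= e.
Proof.
move=> e0; have [N _ h] := near_infty_natSinv_lt (PosNum e0).
by exists N => n Nn; apply/ltW/h.
Qed.

Lemma posC_real (R : realType) (z : R[i]) : 0 < z -> exists2 e : R, 0 < e & z = e%:C.
Proof.
move=> z0; have zr : z \is Num.real by rewrite gtr0_real.
by exists (complex.Re z); rewrite ?RRe_real// -ltcR RRe_real.
Qed.

Section Complete.
Variables (R : realType) (H : hilbertType R).
Implicit Types (x y : H).

(** Bridge from filter completeness over [R[i]] to ranks and real bounds, the form in which limits
    of vectors are produced below. *)
Lemma rnorm_cauchy (u : nat -> H) :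
  (forall e : R, 0 < e -> exists N : nat, forall m n, (N <= m)%N -> (N <= n)%N ->
     rnorm (u m - u n) <= e) ->
  exists l : H, forall e : R, 0 < e ->
     exists N : nat, forall n, (N <= n)%N -> rnorm (u n - l) <= e.
Proof.
move=> cu.
have uc : cauchy (u @ \oo).
  apply: cauchy_exP => _ /posC_real[e e0 ->].
  have [N hN] := cu (e / 2) (divr_gt0 e0 (ltr0Sn _ 1)).
  exists (u N); exists N => // n /= Nn.
  rewrite -ball_normE /ball_ /= rnormE ltcR.
  by rewrite (le_lt_trans (hN _ _ _ Nn))// gtr_pMr// invf_lt1// ltr1n.
move/cauchy_cvgP/cvg_ex : uc => [/= l /cvgrPdist_le ul].
exists l => e e0; have e0C : 0 < e%:C by rewrite ltcR.
have [N _ hN] := ul _ e0C; exists N => n Nn.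
by rewrite rnormBC -lecR -rnormE; exact: hN.
Qed.

Definition closed_subspace (M : set H) :=
  [/\ M 0, forall (a : R[i]) x y, M x -> M y -> M (a *: x + y) &
    forall x, (forall e : R, 0 < e -> exists2 m, M m & rnorm (x - m) <= e) -> M x].

(** Moving [p] by [s * c] times [m] lowers the squared distance by [2 s |c|^2] and raises it by
    [s^2 |c|^2 |m|^2]; as [s |m|^2 <= 1], minimality forces [c = 0]. *)
Lemma minimizer_orthogonal (M : set H) x p :
  (forall (a : R[i]) x y, M x -> M y -> M (a *: x + y)) -> M p ->
  (forall m, M m -> rnorm (x - p) <= rnorm (x - m)) ->
  forall m, M m -> '[x - p, m] = 0.
Proof.
move=> Mlin Mp pmin m Mm; set z := x - p in pmin *; set c := '[z, m].
pose s : R := (rnorm m ^+ 2 + 1)^-1.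
have m1 : 0 < rnorm m ^+ 2 + 1 by rewrite ltr_wpDl// sqr_ge0.
have s0 : 0 < s by rewrite invr_gt0.
have /pmin : M ((s%:C * c) *: m + p) by exact: Mlin.
rewrite (_ : x - _ = z - (s%:C * c) *: m); last by rewrite opprD addrCA addrC.
rewrite -(ler_pXn2r (n := 2)) ?nnegrE ?rnorm_ge0// (rnorm_sqrB z) rnormZ rnormM rnormC.
have -> : complex.Re '[z, (s%:C * c) *: m] = s * rnorm c ^+ 2.
  rewrite innerZr -/c conjcM conjc_real -mulrA [conjc _ * _]mulrC -sqr_normc.
  by rewrite rnormE -realcX -realcM.
rewrite gtr0_norm// -addrA lerDl !exprMn.
have sm : s * rnorm m ^+ 2 <= 1.
  by rewrite /s mulrC ler_pdivrMr// mul1r lerDl.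
move=> h.
have : s * rnorm c ^+ 2 * (2 - s * rnorm m ^+ 2) <= 0 by lra.
rewrite pmulr_lle0; last by lra.
rewrite pmulr_rle0// => c0.
apply/eqP; rewrite -rnorm_eq0 -sqrf_eq0; apply/eqP/le_anti.
by rewrite c0 sqr_ge0.
Qed.

Lemma projection (M : set H) x : closed_subspace M ->
  exists2 p, M p & forall m, M m -> '[x - p, m] = 0.
Proof.
move=> [M0 Mlin Mcl].
pose D := [set rnorm (x - m) | m in M].
have Dlb : lbound D 0 by move=> _ [m _ <-]; exact: rnorm_ge0.
have Dinf : has_inf D by split; [exists (rnorm (x - 0)); exists 0 | exists 0].
pose d := inf D.
have d0 : 0 <= d by apply: lb_le_inf => //; case: Dinf.
have dle m : M m -> d <= rnorm (x - m).
  by move=> Mm; apply: ge_inf; [exists 0 | exists m].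
have /choice[u hu] n : exists m, M m /\ rnorm (x - m) <= d + n.+1%:R^-1.
  have n0 : 0 < n.+1%:R^-1 :> R by rewrite invr_gt0.
  have [_ [m Mm <-] h] := inf_adherent n0 Dinf.
  by exists m; split => //; exact: ltW.
(* Parallelogram law: the midpoint of [u m] and [u n] lies in [M], at distance at least [d] from
   [x], so [|u m - u n|^2 <= 4 (d + a)^2 - 4 d^2]. *)
have dist m n (a : R) : rnorm (x - u m) <= d + a -> rnorm (x - u n) <= d + a ->
    0 <= a -> rnorm (u m - u n) ^+ 2 <= 8 * d * a + 4 * a ^+ 2.
  move=> hm hn a0.
  have Mh : M (2^-1 *: (u m + u n)).
    rewrite -[X in M X]addr0; apply: (Mlin) => //.
    by rewrite -[u m]scale1r; apply: Mlin; apply: (hu _).1.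
  have := dle _ Mh.
  have -> : x - 2^-1 *: (u m + u n) = 2^-1 *: ((x - u m) + (x - u n)).
    rewrite addrACA -opprD scalerBr; congr (_ - _).
    rewrite scalerDr -scalerDl (_ : 2^-1 + 2^-1 = 1); last by field.
    by rewrite scale1r.
  rewrite rnormZ rnormV (_ : 2 = (2 : R)%:C); last by rewrite rmorphMn rmorph1.
  rewrite rnormC ger0_norm// ler_pdivlMl// => hd.
  have := rnorm_sqrD (x - u m) (x - u n); have := rnorm_sqrB (x - u n) (x - u m).
  rewrite (_ : x - u n - _ = u m - u n); last by rewrite opprB addrC addrA subrK.
  rewrite (inner_ReC (x - u n)).
  have := rnorm_ge0 (x - u m); have := rnorm_ge0 (x - u n).
  move: (rnorm _) hd hm (rnorm (x - u n)) hn (rnorm (u m - u n))=> A.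
  move: (rnorm (x - u m)) => B hd hB C hC E C0 B0 e1 e2.
  have : (2 * d) ^+ 2 <= A ^+ 2 by rewrite ler_pXn2r ?nnegrE//; lra.
  have : B ^+ 2 <= (d + a) ^+ 2 by rewrite ler_pXn2r ?nnegrE//; lra.
  have : C ^+ 2 <= (d + a) ^+ 2 by rewrite ler_pXn2r ?nnegrE//; lra.
  by rewrite e2 e1 !exprMn !sqrrD; nra.
have [|p up] := @rnorm_cauchy u.
  move=> e e0.
  have d4 : 0 < 8 * d + 4 by lra.
  (* For [a <= 1], [8 d a + 4 a^2 <= (8 d + 4) a], and the minimum makes this at most [e^2]. *)
  have m0 : 0 < Num.min 1 (e ^+ 2 / (8 * d + 4)).
    by rewrite lt_min ltr01 divr_gt0// exprn_gt0.
  have [N hN] := invS_le m0.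
  exists N => m n Nm Nn.
  rewrite -(ler_pXn2r (n := 2)) ?nnegrE ?rnorm_ge0 ?(ltW e0)//.
  have := hN _ (leqnn N); set a := N.+1%:R^-1.
  have a0 : 0 <= a by rewrite invr_ge0.
  rewrite le_min ler_pdivlMr// => /andP[a1 ae].
  apply: le_trans (dist m n a _ _ a0) _; last by nra.
    by apply: le_trans (hu m).2 _; rewrite lerD2l lef_pV2 ?posrE// ler_nat.
  by apply: le_trans (hu n).2 _; rewrite lerD2l lef_pV2 ?posrE// ler_nat.
have Mp : M p.
  apply: Mcl => e /up[N hN]; exists (u N); first exact: (hu N).1.
  by rewrite rnormBC hN.
exists p => //; apply: minimizer_orthogonal => // m Mm.
apply: le_trans (dle _ Mm); apply/ler_addgt0Pr => e e0.
have e20 : 0 < e / 2 by rewrite divr_gt0.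
have [N hN] := up _ e20; have [N' hN'] := invS_le e20.
have := hN _ (leq_maxl N N'); have := hN' _ (leq_maxr N N').
have := (hu (maxn N N')).2; have := rnorm_triangle x (u (maxn N N')) p.
by move: ((maxn N N').+1%:R^-1) => a; lra.
Qed.

End Complete.

(** * Bounded operators *)

Section Operators.
Variables (R : realType) (H : hilbertType R).
Implicit Types (x y z : H) (a : R[i]) (S T U : bop H).

Lemma bop_eq S T : (forall x, S x = T x) -> S = T.
Proof. by move=> h; apply/val_inj/funext. Qed.

Lemma bopDE S T x : (S + T) x = S x + T x. Proof. by []. Qed.
Lemma bopNE S x : (- S) x = - S x. Proof. by []. Qed.
Lemma bopBE S T x : (S - T) x = S x - T x. Proof. by []. Qed.
Lemma bopZE a S x : (a *: S) x = a *: S x. Proof. by []. Qed.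
Lemma bopME S T x : (S * T) x = S (T x). Proof. by []. Qed.
Lemma bop1E x : (1 : bop H) x = x. Proof. by []. Qed.
Lemma bop0E x : (0 : bop H) x = 0. Proof. by []. Qed.
Definition bopE := (bopDE, bopNE, bopZE, bopME, bop1E, bop0E).

Lemma bop_linearP a S x y : S (a *: x + y) = a *: S x + S y.
Proof. exact: linearP. Qed.

Lemma bop_linearB S x y : S (x - y) = S x - S y.
Proof. exact: linearB. Qed.

Lemma bopZMl a S T : (a *: S) * T = a *: (S * T).
Proof. by apply: bop_eq. Qed.

Lemma bopZMr a S T : S * (a *: T) = a *: (S * T).
Proof. by apply: bop_eq => x; rewrite !bopE linearZ. Qed.

Lemma bop_bound T : exists2 M : R, 0 <= M & forall x, rnorm (T x) <= M * rnorm x.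
Proof.
have /linear_bounded_continuous/linear_boundedP/pinfty_ex_gt0 [M M0 hM] :=
  bop_continuous (T := T).
have [r r0 rM] := posC_real M0; exists r; first exact: ltW.
by move=> x; rewrite -lecR realcM -!rnormE -rM; exact: hM.
Qed.

Lemma opnorm_has_sup T :
  has_sup [set rnorm (T x) | x in [set x | rnorm x <= 1]].
Proof.
split; first by exists (rnorm (T 0)); exists 0; rewrite //= rnorm0.
have [M M0 hM] := bop_bound T; exists M => _ [x /= x1 <-].
by rewrite (le_trans (hM x))// ler_piMr.
Qed.

Lemma opnorm_ge0 T : 0 <= opnorm T.
Proof.
apply: ub_le_sup; first exact: (opnorm_has_sup T).2.
by exists 0; rewrite /= ?linear0 rnorm0.
Qed.

Lemma opnorm_le T x : rnorm (T x) <= opnorm T * rnorm x.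
Proof.
have [->|x0] := eqVneq x 0; first by rewrite linear0 rnorm0 mulr0.
have nx : 0 < rnorm x by rewrite lt_def rnorm_ge0 rnorm_eq0 x0.
rewrite -ler_pdivrMr//; apply: ub_le_sup; first exact: (opnorm_has_sup T).2.
exists ((rnorm x)^-1%:C *: x) => /=; last first.
  by rewrite linearZ rnormZ rnormC gtr0_norm ?invr_gt0// mulrC.
by rewrite rnormZ rnormC gtr0_norm ?invr_gt0// mulVf ?gt_eqF.
Qed.

Lemma opnorm_ub T (M : R) :
  0 <= M -> (forall x, rnorm (T x) <= M * rnorm x) -> opnorm T <= M.
Proof.
move=> M0 hM; apply: ge_sup; first exact: (opnorm_has_sup T).1.
by move=> _ [x /= x1 <-]; rewrite (le_trans (hM x))// ler_piMr.
Qed.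

Lemma opnorm_eq0 T : opnorm T <= 0 -> T = 0.
Proof.
move=> h; apply: bop_eq => x; apply/eqP; rewrite -rnorm_eq0 eq_le rnorm_ge0 andbT.
by rewrite (le_trans (opnorm_le T x))// mulr_le0_ge0// rnorm_ge0.
Qed.

Lemma opnorm_eps T : (forall e : R, 0 < e -> opnorm T <= e) -> T = 0.
Proof.
by move=> h; apply: opnorm_eq0; apply/ler_addgt0Pr => e e0; rewrite add0r h.
Qed.

Lemma opnormD S T : opnorm (S + T) <= opnorm S + opnorm T.
Proof.
apply: opnorm_ub; first by rewrite addr_ge0 ?opnorm_ge0.
by move=> x; rewrite (le_trans (rnormD _ _))// mulrDl lerD ?opnorm_le.
Qed.

Lemma opnormZ a T : opnorm (a *: T) = rnorm a * opnorm T.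
Proof.
have le (b : R[i]) (U : bop H) : opnorm (b *: U) <= rnorm b * opnorm U.
  apply: opnorm_ub; first by rewrite mulr_ge0 ?rnorm_ge0 ?opnorm_ge0.
  by move=> x; rewrite rnormZ -mulrA ler_wpM2l ?rnorm_ge0 ?opnorm_le.
apply/le_anti; rewrite le /=.
have [->|a0] := eqVneq a 0; first by rewrite rnorm0 mul0r opnorm_ge0.
have na : 0 < rnorm a by rewrite lt_def rnorm_ge0 rnorm_eq0 a0.
have := le a^-1 (a *: T); rewrite scalerA mulVf// scale1r rnormV.
by rewrite ler_pdivlMl.
Qed.

Lemma opnormN T : opnorm (- T) = opnorm T.
Proof. by rewrite -scaleN1r opnormZ rnormN rnorm1 mul1r. Qed.

Lemma opnormB S T : opnorm (S - T) <= opnorm S + opnorm T.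
Proof. by rewrite -(opnormN T) opnormD. Qed.

Lemma opnormBC S T : opnorm (S - T) = opnorm (T - S).
Proof. by rewrite -opnormN opprB. Qed.

Lemma opnorm_triangle S T U : opnorm (S - U) <= opnorm (S - T) + opnorm (T - U).
Proof. by rewrite (_ : S - U = (S - T) + (T - U)) ?opnormD// addrA subrK. Qed.

Lemma opnormM S T : opnorm (S * T) <= opnorm S * opnorm T.
Proof.
apply: opnorm_ub; first by rewrite mulr_ge0 ?opnorm_ge0.
move=> x; rewrite bopME (le_trans (opnorm_le S (T x)))// -mulrA.
by rewrite ler_wpM2l ?opnorm_ge0 ?opnorm_le.
Qed.

Lemma opnorm0 : opnorm (0 : bop H) = 0.
Proof. by rewrite -(scale0r (1 : bop H)) opnormZ rnorm0 mul0r. Qed.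

Lemma opnorm1 : opnorm (1 : bop H) <= 1.
Proof. by apply: opnorm_ub => // x; rewrite mul1r. Qed.

Lemma opnormX T n : opnorm (T ^+ n) <= opnorm T ^+ n.
Proof.
elim: n => [|n IHn]; first by rewrite !expr0 opnorm1.
rewrite exprS [leRHS]exprS (le_trans (opnormM _ _))//.
by rewrite ler_wpM2l ?opnorm_ge0.
Qed.

(* Lets an operator (an inverse, an adjoint, a limit, a polar isometry) be given
   by the relation that its values satisfy rather than by a formula. *)
Lemma bop_of_relation (G : H -> H -> Prop) (C : R) :
  (forall a x u y v, G x u -> G y v -> G (a *: x + y) (a *: u + v)) ->
  (forall x, exists u, G x u) ->
  (forall x u, G x u -> rnorm u <= C * rnorm x) ->
  exists T : bop H, forall x, G x (T x).
Proof.
move=> Glin /choice[f Gf] GC.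
have Guniq x u v : G x u -> G x v -> u = v.
  move=> Gu Gv; have := Glin (-1) _ _ _ _ Gu Gv.
  rewrite scaleN1r addNr scaleN1r => /GC; rewrite rnorm0 mulr0 => h.
  apply/esym/eqP; rewrite -subr_eq0 -rnorm_eq0 eq_le rnorm_ge0 andbT.
  by rewrite addrC.
have flin : linear f by move=> a x y; apply: Guniq (Gf _) (Glin _ _ _ _ _ _ _).
pose L := GRing.isLinear.Build _ _ _ _ f flin.
pose F : {linear H -> H} := HB.pack f L.
have Fc : continuous F.
  apply/linear_bounded_continuous/linear_boundedP.
  exists C%:C; split; first by apply/complex_realP; exists C.
  move=> r Cr x; rewrite (le_trans (y := C%:C * `|x|))//.
    by rewrite !rnormE -realcM lecR; exact: GC.
  by rewrite ler_wpM2r// ltW.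
have Fb : (F : H -> H) \in @bounded_operator R H by apply/bopP; split.
by exists (Bop Fb).
Qed.

(** The limit is taken pointwise; since the Cauchy ranks do not depend on the vector, convergence is
    recovered in operator norm. *)
Lemma bop_complete (u : nat -> bop H) :
  (forall e : R, 0 < e -> exists N : nat, forall m n, (N <= m)%N -> (N <= n)%N ->
     opnorm (u m - u n) <= e) ->
  exists T : bop H, forall e : R, 0 < e ->
    exists N : nat, forall n, (N <= n)%N -> opnorm (u n - T) <= e.
Proof.
move=> cu.
pose G x y := forall e : R, 0 < e ->
  exists N : nat, forall n, (N <= n)%N -> rnorm (u n x - y) <= e.
have [N hN] := cu 1 ltr01.
have [T hT] : exists T : bop H, forall x, G x (T x).
  (* From rank [N] on, [u n] stays within 1 of [u N], which bounds the limit. *)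
  apply: (@bop_of_relation G (opnorm (u N) + 1)).
  - move=> a x x' y y' Gx Gy e e0.
    have a1 : 0 < rnorm a + 1 by rewrite ltr_wpDl ?rnorm_ge0.
    have e1 : 0 < e / (rnorm a + 1) by rewrite divr_gt0.
    have [N1 h1] := Gx _ e1; have [N2 h2] := Gy _ e1.
    exists (maxn N1 N2) => n; rewrite geq_max => /andP[/h1 {}h1 /h2 {}h2].
    rewrite linearP opprD addrACA -scalerBr (le_trans (rnormD _ _))// rnormZ.
    have -> : e = rnorm a * (e / (rnorm a + 1)) + e / (rnorm a + 1).
      by field; rewrite gt_eqF.
    by rewrite lerD// ler_wpM2l ?rnorm_ge0.
  - move=> x; apply: rnorm_cauchy => e e0.
    have x1 : 0 < rnorm x + 1 by rewrite ltr_wpDl ?rnorm_ge0.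
    have [M hM] := cu _ (divr_gt0 e0 x1); exists M => m n Mm Mn.
    rewrite -bopBE (le_trans (opnorm_le _ _))//.
    have := hM m n Mm Mn; rewrite ler_pdivlMr//; apply: le_trans.
    by rewrite ler_wpM2l ?opnorm_ge0// lerDl.
  - move=> x y Gy; apply/ler_addgt0Pr => e /Gy[M hM].
    have := hM _ (leq_maxr N M).
    have := hN _ _ (leq_maxl N M) (leqnn N).
    have := opnorm_le (u (maxn N M) - u N) x; rewrite bopBE.
    set w := u (maxn N M) x => h1 h2 h3.
    have := rnorm_triangle y w 0; rewrite !subr0 rnormBC.
    have := rnorm_triangle w (u N x) 0; rewrite !subr0.
    have := opnorm_le (u N) x; have := rnorm_ge0 x.
    move: h1 h2 h3; move: (opnorm (_ - _)) => A.
    move: (rnorm (w - _)) (rnorm (w - y)) (rnorm w) (rnorm x) (opnorm _) => B C D E F.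
    by move=> *; nra.
exists T => e e0.
have e20 : 0 < e / 2 by rewrite divr_gt0.
have [M hM] := cu _ e0; exists M => n Mn.
apply: opnorm_ub => [|x]; first exact: ltW.
apply/ler_addgt0Pr => d d0; have [M' hM'] := hT x _ d0.
have := hM' _ (leq_maxl M' M); have := hM _ _ Mn (leq_maxr M' M).
have := opnorm_le (u n - u (maxn M' M)) x; rewrite !bopBE.
have := rnorm_triangle (u n x) (u (maxn M' M) x) (T x).
have := rnorm_ge0 x.
move: (opnorm _) (rnorm x) (rnorm _) (rnorm (_ - _)) (rnorm (_ - _)) => A B C D E.
by move=> *; nra.
Qed.

End Operators.

(** * Adjoints and coercive operators *)

Section LaxMilgram.
Variables (R : realType) (H : hilbertType R).
Implicit Types (x y : H) (a z : R[i]) (S T A : bop H).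

(** For [z] orthogonal to the kernel, [phi z *: x - phi x *: z] is in the kernel, and pairing it
    with [z] yields [phi x]. *)
Lemma riesz (phi : H -> R[i]) (C : R) :
  (forall a x y, phi (a *: x + y) = a * phi x + phi y) ->
  (forall x, rnorm (phi x) <= C * rnorm x) ->
  exists v, forall x, phi x = '[x, v].
Proof.
move=> philin phiC.
have phi0 : phi 0 = 0.
  by have := philin (-1) 0 0; rewrite scaler0 addr0 mulN1r addNr.
have phiB x y : phi (x - y) = phi x - phi y.
  by rewrite addrC -scaleN1r philin mulN1r addrC.
pose K := [set x | phi x = 0].
have Kcl : closed_subspace K.
  split => // [a x y /= px py|x h]; first by rewrite /K /= philin px py mulr0 addr0.
  (* [C] may be negative, hence the maximum with 0. *)
  have Cx e : 0 < e -> rnorm (phi x) <= Num.max 0 C * e.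
    move=> /h[m /= pm xm]; rewrite -[phi x]subr0 -pm -phiB.
    rewrite (le_trans (phiC _))//.
    have := rnorm_ge0 (x - m); have : C <= Num.max 0 C by rewrite le_max lexx orbT.
    have : 0 <= Num.max 0 C by rewrite le_max lexx.
    move: (Num.max 0 C) => D D0 CD r0.
    by rewrite (le_trans (ler_wpM2r r0 CD))// ler_wpM2l.
  apply: rnorm_eps => e e0.
  have M0 : 0 < Num.max 0 C + 1 by rewrite ltr_wpDl// le_max lexx.
  rewrite (le_trans (Cx _ (divr_gt0 e0 M0)))// mulrA ler_pdivrMr// mulrC.
  by rewrite ler_wpM2l ?lerDl// ltW.
have [allK|] := pselect (forall x, K x).
  by exists 0 => x; rewrite inner0r; exact: allK.
move=> /existsNP[x0 /= phix0].
have [p Kp hp] := projection x0 Kcl; set z := x0 - p in hp.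
have phiz : phi z <> 0 by rewrite /z phiB Kp subr0.
have zz : '[z, z] != 0.
  by apply/eqP => /inner_eq0 z0; apply: phiz; rewrite z0.
exists (conjc (phi z / '[z, z]) *: z) => x.
have : K (phi z *: x - phi x *: z).
  by rewrite /K /= addrC -scaleNr philin -[phi z *: x]addr0 philin phi0; ring.
move=> /hp /innerC_eq0; rewrite innerBl !innerZl innerZr conjcK => /eqP.
by rewrite subr_eq0 => /eqP e; rewrite mulrAC e mulfK.
Qed.

(** Riesz represents [x |-> '[T x, y]]; testing the representative [v] on itself gives [|v|^2 =
    '[T v, y]], which bounds [|v|] by [|T| |y|]. *)
Lemma adjoint_exists T : exists S : bop H, forall x y, '[T x, y] = '[x, S y].
Proof.
pose G y v := forall x, '[T x, y] = '[x, v].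
suff [S hS] : exists S : bop H, forall y, G y (S y) by exists S => x y; exact: hS.
apply: (@bop_of_relation _ _ G (opnorm T)).
- by move=> a x u y v Gx Gy z; rewrite !innerDr !innerZr Gx Gy.
- move=> y; apply: (riesz (C := opnorm T * rnorm y)).
    by move=> a x z; rewrite linearP innerDl innerZl.
  move=> x; rewrite (le_trans (cauchy_schwarz _ _))// mulrAC.
  by rewrite ler_wpM2r ?rnorm_ge0 ?opnorm_le.
move=> y v Gy.
have [->|v0] := eqVneq v 0; first by rewrite rnorm0 mulr_ge0 ?rnorm_ge0 ?opnorm_ge0.
have nv : 0 < rnorm v by rewrite lt_def rnorm_ge0 rnorm_eq0 v0.
have : rnorm v ^+ 2 <= rnorm '[T v, y].
  by rewrite Gy inner_rnorm rnormC ger0_norm ?sqr_ge0.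
move/le_trans => /(_ _ (cauchy_schwarz _ _)) h.
rewrite -(ler_pM2l nv) -expr2 (le_trans h)// mulrCA mulrA.
by rewrite ler_wpM2r ?rnorm_ge0 ?opnorm_le.
Qed.

Lemma adjointE T x y : '[T x, y] = '[x, adjoint T y].
Proof. by have /(xgetPex 0) := adjoint_exists T; apply. Qed.

Lemma bounded_below_range_closed S (c : R) : 0 < c ->
  (forall x, c * rnorm x <= rnorm (S x)) -> closed_subspace (range S).
Proof.
move=> c0 hc; split.
- by exists 0; rewrite ?linear0.
- by move=> a _ _ [x _ <-] [y _ <-]; exists (a *: x + y); rewrite ?linearP.
move=> x h.
have /choice[y hy] n : exists y, rnorm (x - S y) <= n.+1%:R^-1.
  have n0 : 0 < n.+1%:R^-1 :> R by rewrite invr_gt0.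
  by have [_ [y _ <-] hy] := h _ n0; exists y.
have [e e0|l yl] := @rnorm_cauchy _ _ y.
  have [N hN] := invS_le (divr_gt0 (mulr_gt0 c0 e0) (ltr0Sn R 1)).
  exists N => m n Nm Nn; rewrite -(ler_pM2l c0) (le_trans (hc _))// bop_linearB.
  rewrite (le_trans (rnorm_triangle _ x _))// (rnormBC (S (y m))).
  have := hN _ Nm; have := hN _ Nn; have := hy m; have := hy n.
  by move: (n.+1%:R^-1) (m.+1%:R^-1) => a b; lra.
exists l => //; apply/esym/eqP; rewrite -subr_eq0; apply/eqP/rnorm_eps => e e0.
have S1 : 0 < opnorm S + 1 by rewrite ltr_wpDl ?opnorm_ge0.
have e20 : 0 < e / 2 by rewrite divr_gt0.
have [N hN] := invS_le e20; have [M hM] := yl _ (divr_gt0 e20 S1).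
pose n := maxn N M; rewrite (le_trans (rnorm_triangle _ (S (y n)) _))//.
have := le_trans (hy n) (hN _ (leq_maxl _ _)).
rewrite -bop_linearB; have := opnorm_le S (y n - l).
have := hM _ (leq_maxr N M); rewrite -/n ler_pdivlMr//.
have := rnorm_ge0 (y n - l); have := opnorm_ge0 S.
move: (rnorm (y n - l)) (opnorm S) (rnorm (S _)) (rnorm _) => B C D E *; nra.
Qed.

(** Coercivity bounds [S] below, so its range is closed; a [w] orthogonal to the range has
    ['[S w, w] = 0], hence vanishes. The three localizations of the spectrum below (norm disk, real
    line, half-line) are instances. *)
Lemma lax_milgram S (c : R) : 0 < c ->
  (forall x, c * rnorm x ^+ 2 <= rnorm '[S x, x]) -> invertible S.
Proof.
move=> c0 hc.
have below x : c * rnorm x <= rnorm (S x).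
  have [->|x0] := eqVneq x 0; first by rewrite linear0 rnorm0 mulr0.
  have nx : 0 < rnorm x by rewrite lt_def rnorm_ge0 rnorm_eq0 x0.
  rewrite -(ler_pM2r nx) -mulrA -expr2 (le_trans (hc x))//.
  exact: cauchy_schwarz.
have Ssurj x : exists y, S y = x.
  have [_ [y _ <-] hy] := projection x (bounded_below_range_closed c0 below).
  set w := x - S y in hy; exists y; apply/esym/eqP; rewrite -subr_eq0 -/w.
  have /innerC_eq0 w0 : '[w, S w] = 0 by apply: hy; exists w.
  have := hc w; rewrite w0 rnorm0 pmulr_rle0// => ww.
  by rewrite -rnorm_eq0 -sqrf_eq0 eq_le ww sqr_ge0.
have [V hV] : exists V : bop H, forall x, S (V x) = x.
  apply: (@bop_of_relation _ _ (fun x y => S y = x) c^-1) => //.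
    by move=> a x u y v <- <-; rewrite linearP.
  by move=> x u <-; rewrite ler_pdivlMl.
exists V; split; apply: bop_eq => x; last exact: hV.
rewrite bopE bop1E; apply/eqP; rewrite -subr_eq0 -rnorm_eq0 eq_le rnorm_ge0 andbT.
rewrite -(pmulr_rle0 _ c0) (le_trans (below _))// bop_linearB.
by rewrite hV subrr rnorm0.
Qed.

Lemma inner_subZ A z x :
  '[(A - z *: (1 : bop H)) x, x] = '[A x, x] - z * (rnorm x ^+ 2)%:C.
Proof. by rewrite bopBE innerBl bopZE innerZl inner_rnorm. Qed.

Lemma spectrum_le_opnorm A z : spectrum A z -> rnorm z <= opnorm A.
Proof.
move=> sz; rewrite leNgt; apply/negP => Az; apply: sz.
apply: (@lax_milgram _ (rnorm z - opnorm A)); first by rewrite subr_gt0.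
move=> x; rewrite inner_subZ.
have := rnorm_triangle (z * (rnorm x ^+ 2)%:C) '[A x, x] 0; rewrite !subr0.
rewrite rnormBC rnormM rnormC (ger0_norm (sqr_ge0 _)).
have := cauchy_schwarz (A x) x; have := opnorm_le A x; have := rnorm_ge0 x.
rewrite mulrBl.
by move: (rnorm (A x)) (rnorm '[_, _]) (rnorm (_ - _)) => B C D *; nra.
Qed.

Definition selfadjoint A := forall x y, '[A x, y] = '[x, A y].

Lemma selfadjoint_Im A x : selfadjoint A -> complex.Im '[A x, x] = 0.
Proof.
by move=> sA; have := innerC (A x) x; rewrite -sA; case: '[_, _] => u v [] /=; lra.
Qed.

Lemma spectrum_selfadjoint A z : selfadjoint A -> spectrum A z ->
  z = (complex.Re z)%:C.
Proof.
move=> sA sz; apply/eqP; rewrite eq_complex /= eqxx /=.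
apply/negP => z0; apply: sz.
apply: (@lax_milgram _ `|complex.Im z|); first by rewrite normr_gt0; apply/negP.
move=> x; rewrite inner_subZ (le_trans _ (rnorm_Im _))// Im_subM.
by rewrite selfadjoint_Im// sub0r normrN normrM (ger0_norm (sqr_ge0 _)).
Qed.

Definition positive A := selfadjoint A /\ forall x, 0 <= complex.Re '[A x, x].

Lemma spectrum_positive A (t : R) : positive A -> spectrum A t%:C -> 0 <= t.
Proof.
move=> [_ pA] st; rewrite leNgt; apply/negP => t0; apply: st.
apply: (@lax_milgram _ (- t)); first by rewrite oppr_gt0.
move=> x; rewrite inner_subZ (le_trans _ (rnorm_Re _))//.
rewrite (le_trans _ (ler_norm _))//.
by rewrite Re_subM mulNr lerDr pA.
Qed.

End LaxMilgram.

(** * The growth rate of the powers of an operator *)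

(** If [b < c], then [(b / c)^n] tends to 0 and cannot stay above [1 / K]. Infinitely many [n] are
    enough, so powers of two can be used alone. *)
Lemma geometric_le (R : realType) (K b c : R) : 0 < b ->
  (forall N, exists2 n, (N <= n)%N & c ^+ n <= K * b ^+ n) -> c <= b.
Proof.
move=> b0 h; rewrite leNgt; apply/negP => bc.
have c0 : 0 < c by exact: lt_trans bc.
have q1 : `|b / c| < 1.
  by rewrite ger0_norm ?divr_ge0 ?ltW// ltr_pdivrMr// mul1r.
have q0 : 0 <= b / c by rewrite divr_ge0 ?ltW.
have K1 : 0 < (`|K| + 1)^-1 by rewrite invr_gt0 ltr_wpDl.
have /cvgrPdist_lt/(_ _ K1)[N _ hN] := cvg_expr q1.
have [n Nn] := h N; have := hN n Nn; rewrite /= sub0r normrN.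
rewrite ger0_norm ?exprn_ge0 ?q0// expr_div_n.
have cn : 0 < c ^+ n by rewrite exprn_gt0.
rewrite ltr_pdivrMr// mulrC ltr_pdivlMr ?ltr_wpDl// => h1.
have : K * b ^+ n <= `|K| * b ^+ n by rewrite ler_wpM2r ?ler_norm ?exprn_ge0 ?(ltW b0).
have : 0 < b ^+ n by rewrite exprn_gt0.
by move: (`|K|) h1 => L; nra.
Qed.

Section Radius.
Variables (R : realType) (H : hilbertType R).
Implicit Types (x y : H) (a b : R) (z w : R[i]) (S T A B V : bop H).

(* The growth rate of [|T^n|] is the infimum, hence the limit, of [|T^n|^(1/n)];
   this form avoids roots. *)
Definition growth T a := 0 < a /\ exists K : R, forall n, opnorm (T ^+ n) <= K * a ^+ n.

Definition gelfand_radius T : R := inf [set a | growth T a].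

Lemma growth_gt_opnorm T a : opnorm T < a -> growth T a.
Proof.
move=> Ta; have a0 : 0 < a by rewrite (le_lt_trans _ Ta) ?opnorm_ge0.
split=> //; exists 1 => n; rewrite mul1r (le_trans (opnormX _ _))//.
by rewrite lerXn2r ?nnegrE ?opnorm_ge0// ltW.
Qed.

Lemma growth_has_inf T : has_inf [set a | growth T a].
Proof.
split; last by exists 0 => a [/ltW].
by exists (opnorm T + 1); apply: growth_gt_opnorm; rewrite ltrDl.
Qed.

Lemma gelfand_radius_ge0 T : 0 <= gelfand_radius T.
Proof.
by apply: lb_le_inf; [exact: (growth_has_inf T).1 | move=> a [/ltW]].
Qed.

Lemma gelfand_radius_le_growth T a : growth T a -> gelfand_radius T <= a.
Proof. by move=> Ta; apply: ge_inf => //; exact: (growth_has_inf T).2. Qed.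

Lemma gelfand_radius_le_opnorm T : gelfand_radius T <= opnorm T.
Proof.
apply/ler_addgt0Pr => e e0; apply/gelfand_radius_le_growth/growth_gt_opnorm.
by rewrite ltrDl.
Qed.

Lemma gelfand_radius_lt T a : gelfand_radius T < a ->
  exists2 K : R, 0 < K & forall n, opnorm (T ^+ n) <= K * a ^+ n.
Proof.
move=> Ta; have a0 : 0 < a - gelfand_radius T by rewrite subr_gt0.
have [b [b0 [K hK]]] := inf_adherent a0 (growth_has_inf T).
rewrite addrC subrK => ba; exists (Num.max K 1).
  by rewrite lt_max ltr01 orbT.
have K0 : 0 <= Num.max K 1 by rewrite le_max ler01 orbT.
move=> n; rewrite (le_trans (hK n))//.
apply: (@le_trans _ _ (Num.max K 1 * b ^+ n)).
  by rewrite ler_wpM2r ?exprn_ge0 ?(ltW b0)// le_max lexx.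
rewrite ler_wpM2l// lerXn2r ?nnegrE ?(ltW b0) ?(ltW ba)//.
exact: le_trans (ltW b0) (ltW ba).
Qed.

(** Writing [n = q m + i] with [i < m], the factor [T ^+ (q m)] grows at rate [a] and the finitely
    many remainders go into the constant. *)
Lemma growth_of_power T a m : (0 < m)%N -> 0 < a -> opnorm (T ^+ m) <= a ^+ m ->
  growth T a.
Proof.
move=> m0 a0 hm; split => //; exists (\sum_(i < m) opnorm (T ^+ i) / a ^+ i) => n.
rewrite {1}(divn_eq n m) exprD mulnC exprM.
rewrite (le_trans (opnormM _ _))//.
have r0 : (n %% m < m)%N by rewrite ltn_mod.
have an i : 0 < a ^+ i by rewrite exprn_gt0.
apply: (@le_trans _ _ ((a ^+ m) ^+ (n %/ m) * opnorm (T ^+ (n %% m)))).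
  rewrite ler_wpM2r ?opnorm_ge0// (le_trans (opnormX _ _))//.
  by rewrite lerXn2r ?nnegrE ?opnorm_ge0 ?(ltW (an _)).
rewrite {3}(divn_eq n m) exprD mulnC exprM mulrCA ler_wpM2l ?exprn_ge0 ?(ltW a0)//.
rewrite -ler_pdivrMr// (bigD1 (Ordinal r0))//= lerDl sumr_ge0// => i _.
by rewrite divr_ge0 ?opnorm_ge0 ?ltW.
Qed.

(** By [growth_of_power], any number above the [n]-th root of [|T^n|] is a growth rate; the slack
    [e] keeps it positive when the root is 0. *)
Lemma gelfand_radius_le_opnormX T n : (0 < n)%N -> gelfand_radius T ^+ n <= opnorm (T ^+ n).
Proof.
move=> n0; set c := opnorm (T ^+ n).
have c0 : 0 <= c by exact: opnorm_ge0.
pose s := c `^ n%:R^-1.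
have sn : s ^+ n = c.
  by rewrite -powR_mulrn ?powR_ge0// -powRrM mulVf ?pnatr_eq0 -?lt0n// powRr1.
rewrite -sn ler_pXn2r ?nnegrE ?gelfand_radius_ge0 ?powR_ge0//.
apply/ler_addgt0Pr => e e0; apply: gelfand_radius_le_growth.
have se : 0 < s + e by rewrite ltr_wpDl ?powR_ge0.
apply: (growth_of_power n0 se); rewrite -/c -sn.
by rewrite ler_pXn2r ?nnegrE ?powR_ge0 ?(ltW se)// lerDl ltW.
Qed.

Lemma gelfand_radiusX T k : (0 < k)%N -> gelfand_radius T ^+ k <= gelfand_radius (T ^+ k).
Proof.
move=> k0; apply: lb_le_inf; first exact: (growth_has_inf _).1.
move=> b [b0 [K hK]]; apply: (geometric_le (K := K)) => // N.
(* [gelfand_radius_le_opnormX] needs a positive exponent. *)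
exists N.+1 => //; rewrite (le_trans _ (hK _))// -!exprM gelfand_radius_le_opnormX//.
by rewrite muln_gt0 k0.
Qed.

Lemma exprM_shift A B n : (A * B) ^+ n.+1 = A * (B * A) ^+ n * B.
Proof.
elim: n => [|n IHn]; first by rewrite expr1 expr0 mulr1.
by rewrite exprSr IHn [in RHS]exprSr !mulrA.
Qed.

(** By [exprM_shift], passing from [(B A)^n] to [(A B)^(n+1)] costs constant factors, invisible to
    the growth rate. *)
Lemma gelfand_radius_comm_le A B : gelfand_radius (A * B) <= gelfand_radius (B * A).
Proof.
apply: lb_le_inf; first exact: (growth_has_inf _).1.
move=> a [a0 [K hK]]; apply: gelfand_radius_le_growth; split=> //.
(* The summand 1 serves exponent 0; the division by [a] makes up for the shift of exponent. *)
exists (1 + opnorm A * `|K| * opnorm B / a) => -[|n].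
  rewrite !expr0 mulr1 (le_trans (opnorm1 _))// lerDl.
  by rewrite divr_ge0 ?mulr_ge0 ?opnorm_ge0 ?(ltW a0).
rewrite exprM_shift (le_trans (opnormM _ _))//.
apply: (@le_trans _ _ (opnorm A * (`|K| * a ^+ n) * opnorm B)).
  rewrite ler_wpM2r ?opnorm_ge0// (le_trans (opnormM _ _))//.
  rewrite ler_wpM2l ?opnorm_ge0// (le_trans (hK n))//.
  by rewrite ler_wpM2r ?ler_norm ?exprn_ge0 ?(ltW a0).
rewrite exprS mulrDl mul1r.
have -> : opnorm A * `|K| * opnorm B / a * (a * a ^+ n) =
   opnorm A * (`|K| * a ^+ n) * opnorm B by field; rewrite gt_eqF.
by rewrite lerDr mulr_ge0 ?exprn_ge0 ?(ltW a0).
Qed.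

Lemma gelfand_radius_comm A B : gelfand_radius (A * B) = gelfand_radius (B * A).
Proof. by apply/le_anti; rewrite !gelfand_radius_comm_le. Qed.

(** The inverse is [B * S], two-sided because [S] commutes with [B]. *)
Lemma invertible_commM A B : A * B = B * A -> invertible (A * B) -> invertible A.
Proof.
move=> AB [S [SAB ABS]].
have e : S * B = B * S.
  transitivity (S * (B * (A * B)) * S).
    by rewrite -(mulrA S) -(mulrA B) ABS mulr1.
  by rewrite (mulrA B) -AB -(mulrA A) (mulrA A) (mulrA S) SAB mul1r.
exists (B * S); split; last by rewrite mulrA.
by rewrite -e -mulrA -AB.
Qed.

Lemma scalar_exp z n : (z *: (1 : bop H)) ^+ n = z ^+ n *: (1 : bop H).
Proof.
elim: n => [|n IHn]; first by rewrite !expr0 scale1r.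
by rewrite exprS IHn bopZMl mul1r scalerA -exprS.
Qed.

Lemma bop_exprZ z T n : (z *: T) ^+ n = z ^+ n *: T ^+ n.
Proof.
elim: n => [|n IHn]; first by rewrite !expr0 scale1r.
by rewrite !exprS IHn bopZMl bopZMr scalerA.
Qed.

Lemma scalar_comm z T : T * (z *: (1 : bop H)) = (z *: (1 : bop H)) * T.
Proof. by rewrite bopZMr bopZMl mulr1 mul1r. Qed.

(** [T - z] divides [T^N - z^N] with a commuting quotient, so [z^N] is in the spectrum of [T^N] and
    [|z|^N <= |T^N| <= K a^N]. *)
Lemma spectrum_le_gelfand_radius T z : spectrum T z -> rnorm z <= gelfand_radius T.
Proof.
move=> sz; rewrite leNgt; apply/negP => Tz.
pose a := (gelfand_radius T + rnorm z) / 2.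
have Ta : gelfand_radius T < a by rewrite /a; lra.
have az : a < rnorm z by rewrite /a; lra.
have a0 : 0 < a by rewrite (le_lt_trans (gelfand_radius_ge0 T)).
have [K K0 hK] := gelfand_radius_lt Ta.
suff : rnorm z <= a by rewrite leNgt az.
apply: (geometric_le (K := K)) => // N; exists N => //.
rewrite -rnormX (le_trans _ (hK N))//; apply: spectrum_le_opnorm => inv; apply: sz.
have c := scalar_comm z T.
have := subrXX_comm N c; rewrite scalar_exp => e; rewrite e in inv.
apply: invertible_commM inv; apply: commr_sum => i _.
have cT : GRing.comm (T - z *: (1 : bop H)) T.
  by apply/commr_sym/commrB.
have cz : GRing.comm (T - z *: (1 : bop H)) (z *: (1 : bop H)).
  by apply/commr_sym/commrB => //; exact/commr_sym.
by apply: commrM; apply: commrX.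
Qed.

End Radius.

(** * Gelfand's formula *)

Section Gelfand.
Variables (R : realType) (H : hilbertType R).
Implicit Types (x y : H) (z w : R[i]) (S T A B V : bop H).

Definition inverse_of S V := S * V = 1 /\ V * S = 1.

Lemma invertibleP S : invertible S <-> exists V, inverse_of S V.
Proof. by split=> -[V []]; exists V. Qed.

Lemma inverse_below S V x : inverse_of S V -> rnorm x <= opnorm V * rnorm (S x).
Proof. by move=> [_ VS]; rewrite -{1}(bop1E x) -VS; exact: (opnorm_le V (S x)). Qed.

Lemma inverse_opnorm S V (c : R) : 0 < c -> (forall x, c * rnorm x <= rnorm (S x)) ->
  inverse_of S V -> opnorm V <= c^-1.
Proof.
move=> c0 hc [SV _]; apply: opnorm_ub; first by rewrite invr_ge0 ltW.
move=> x; rewrite ler_pdivlMl//.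
by rewrite -[in leRHS](bop1E x) -SV; exact: hc.
Qed.

Lemma resolvent_perturb T w w' (c : R) x :
  c * rnorm x <= rnorm ((1 - w *: T) x) ->
  (c - rnorm (w' - w) * opnorm T) * rnorm x <= rnorm ((1 - w' *: T) x).
Proof.
move=> hc; have := rnorm_triangle ((1 - w *: T) x) ((1 - w' *: T) x) 0.
rewrite !subr0.
have -> : (1 - w *: T) x - (1 - w' *: T) x = (w' - w) *: T x.
  rewrite !bopBE !bopZE opprB addrC addrA subrK scalerBl.
  by rewrite addrC.
rewrite rnormZ mulrBl => h.
have := ler_wpM2l (rnorm_ge0 (w' - w)) (opnorm_le T x).
by rewrite mulrA; lra.
Qed.

(* Compactness of the disk, in the form of a uniform lower bound for [1 - wT]. *)
Lemma resolvent_uniform_below T (M : R) :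
  (forall w, rnorm w <= M -> invertible (1 - w *: T)) ->
  exists2 c : R, 0 < c & forall w, rnorm w <= M ->
    forall x, c * rnorm x <= rnorm ((1 - w *: T) x).
Proof.
move=> hinv.
(* The disk is a premise inside [P], so compactness is needed only for the square [K], a product of
   segments. *)
pose P (c : R) (p : R * R) := rnorm (Complex p.1 p.2) <= M ->
  forall x, c * rnorm x <= rnorm ((1 - Complex p.1 p.2 *: T) x).
pose K : set (R * R) := `[- M, M] `*` `[- M, M].
have Kc : compact K by apply: compact_setX; exact: segment_compact.
have T1 : 0 < opnorm T + 1 by rewrite ltr_wpDl ?opnorm_ge0.
have dist (p q : R * R) d : `|p.1 - q.1| <= d -> `|p.2 - q.2| <= d ->
    rnorm (Complex q.1 q.2 - Complex p.1 p.2) <= 2 * d.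
  move=> d1 d2.
  have -> : Complex q.1 q.2 - Complex p.1 p.2 =
      (q.1 - p.1)%:C + Complex 0 1 * (q.2 - p.2)%:C.
    by apply/eqP; rewrite eq_complex /=; apply/andP; split; apply/eqP; ring.
  rewrite (le_trans (rnormD _ _))// rnormM !rnormC (distrC q.1) (distrC q.2).
  have -> : rnorm (Complex 0 1 : R[i]) = 1.
    by rewrite /rnorm normc_def /= expr0n expr1n add0r sqrtr1.
  by lra.
have loc p : K p -> \forall q \near p & c \near (0 : R)^'+, P c q.
  move=> _; set w := Complex p.1 p.2.
  suff [d d0 [c c0 hd]] : exists2 d : R, 0 < d & exists2 c : R, 0 < c &
      forall q c', `|p.1 - q.1| <= d -> `|p.2 - q.2| <= d -> c' <= c -> P c' q.
    exists ([set q : R * R | `|p.1 - q.1| <= d /\ `|p.2 - q.2| <= d],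
            [set c' | c' <= c]) => /=; last first.
      by move=> [q c'] /= [[d1 d2] cc]; exact: hd.
    split; last by apply: nbhs_right_le.
    apply/nbhs_ballP; exists d => //= q [/= q1 q2].
    by split; apply: ltW.
  have [wM|wM] := leP (rnorm w) M; last first.
    (* A quarter of the gap keeps the whole neighbourhood outside the disk, where [P] is vacuous. *)
    pose d := (rnorm w - M) / 4; have d0 : 0 < d by rewrite divr_gt0// subr_gt0.
    exists d => //; exists 1 => // q c' d1 d2 _ qM.
    have := dist p q d d1 d2; have := rnorm_triangle w (Complex q.1 q.2) 0.
    by rewrite !subr0 rnormBC -/w /d => *; lra.
  have [V hV] := (invertibleP _).1 (hinv w wM).
  have V1 : 0 < opnorm V + 1 by rewrite ltr_wpDl ?opnorm_ge0.
  pose c := (opnorm V + 1)^-1; have c0 : 0 < c by rewrite invr_gt0.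
  have hc x : c * rnorm x <= rnorm ((1 - w *: T) x).
    rewrite ler_pdivrMl// (le_trans (inverse_below x hV))//.
    by rewrite ler_wpM2r ?rnorm_ge0// lerDl.
  (* This radius moves [w] by at most [c / (2 (|T| + 1))], which lowers the bound by at most
     [c / 2]. *)
  exists (c / (4 * (opnorm T + 1))); first by rewrite divr_gt0// mulr_gt0.
  exists (c / 2); first by rewrite divr_gt0.
  move=> q c' d1 d2 cc _ x.
  apply: le_trans (@resolvent_perturb T w (Complex q.1 q.2) c x (hc x)).
  rewrite ler_wpM2r ?rnorm_ge0// (le_trans cc)//.
  have := dist p q _ d1 d2; rewrite -/w => dw.
  have : rnorm (Complex q.1 q.2 - w) * opnorm T <= c / 2; last by lra.
  apply: (@le_trans _ _ (2 * (c / (4 * (opnorm T + 1))) * (opnorm T + 1))).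
    by rewrite ler_pM ?rnorm_ge0 ?opnorm_ge0// lerDl.
  by rewrite le_eqVlt; apply/orP; left; apply/eqP; field; rewrite gt_eqF.
have := (compact_near_coveringP K).1 Kc R (0^'+) P _ loc.
case: (pselect (M < 0)) => M0 hnear.
  by exists 1 => // w wM; have := rnorm_ge0 w; lra.
near (0 : R)^'+ => c.
exists c; first by near: c; exact: nbhs_right_gt.
move=> w wM x; case: w wM => a b wM.
have : K `<=` P c by near: c; exact: hnear.
move=> /(_ (a, b)); apply => //; split=> /=.
  by have := le_trans (rnorm_Re _) wM; rewrite /= ler_norml in_itv.
by have := le_trans (rnorm_Im _) wM; rewrite /= ler_norml in_itv.
Unshelve. all: by end_near.
Qed.

End Gelfand.

(** * Rickart's argument: the spectrum reaches the growth rate *)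

Section Rickart.
Variables (R : realType) (H : hilbertType R).
Implicit Types (x y : H) (z w : R[i]) (S T A B V : bop H).

Lemma inverse_ofM S S' V V' : inverse_of S V -> inverse_of S' V' ->
  V - V' = V * (S' - S) * V'.
Proof.
by move=> [_ VS] [S'V' _]; rewrite mulrBr mulrBl VS mul1r -mulrA S'V' mulr1.
Qed.

(** Partial fractions: [2 / (1 - a^2) = 1 / (1 - a) + 1 / (1 + a)]. *)
Lemma inverse_double A V V' : inverse_of (1 - A) V -> inverse_of (1 + A) V' ->
  inverse_of (1 - A * A) ((2^-1 : R)%:C *: (V + V')).
Proof.
move=> [AV VA] [AV' VA'].
have e1 : 1 - A * A = (1 + A) * (1 - A).
  by rewrite mulrDl mul1r mulrBr mulr1 addrA subrK.
have e2 : 1 - A * A = (1 - A) * (1 + A).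
  by rewrite mulrBl mul1r mulrDr mulr1 opprD addrA addrK.
have half : (2^-1 : R)%:C *: ((1 + A) + (1 - A)) = 1.
  rewrite addrACA subrr addr0 scalerDr -scalerDl -realcD.
  by rewrite (_ : _ + _ = 1) ?scale1r//; field.
split.
  by rewrite bopZMr mulrDr {1}e1 e2 -!mulrA AV AV' !mulr1 half.
by rewrite bopZMl mulrDl {1}e2 e1 !mulrA VA VA' !mul1r half.
Qed.

(* [(1 - A^2)^-1] is the mean of [(1 - A)^-1] and [(1 + A)^-1], so a Lipschitz
   bound on the resolvent along rays passes from [A] to [A^2] unchanged. *)
Lemma resolvent_lipschitz T (M c : R) : 0 < c ->
  (forall w, rnorm w <= M -> invertible (1 - w *: T)) ->
  (forall w, rnorm w <= M -> forall x, c * rnorm x <= rnorm ((1 - w *: T) x)) ->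
  forall (k : nat) w (t : R), rnorm w <= M -> 0 <= t <= 1 ->
  exists V V', [/\ inverse_of (1 - (w *: T) ^+ (2 ^ k)) V,
    inverse_of (1 - ((t%:C * w) *: T) ^+ (2 ^ k)) V' &
    opnorm (V - V') <= c^-1 * c^-1 * opnorm T * M * (1 - t)].
Proof.
move=> c0 hinv hc; elim=> [|k IHk] w t wM t01.
  have /andP[t0 t1] := t01.
  have twM : rnorm (t%:C * w) <= M.
    by rewrite rnormM rnormC ger0_norm// (le_trans _ wM)// ler_piMl ?rnorm_ge0.
  have [V hV] := (invertibleP _).1 (hinv w wM).
  have [V' hV'] := (invertibleP _).1 (hinv _ twM).
  exists V, V'; rewrite expn0 !expr1; split=> //.
  rewrite (inverse_ofM hV hV').
  have -> : (1 - (t%:C * w) *: T) - (1 - w *: T) = ((1 - t)%:C * w) *: T.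
    rewrite opprB addrC addrA subrK -scalerBl; congr (_ *: T).
    by rewrite rmorphB rmorph1 /= mulrBl mul1r.
  have hn := inverse_opnorm c0 (hc w wM) hV.
  have hn' := inverse_opnorm c0 (hc _ twM) hV'.
  have c1 : 0 <= c^-1 by rewrite invr_ge0 ltW.
  rewrite (le_trans (opnormM _ _))//.
  have -> : c^-1 * c^-1 * opnorm T * M * (1 - t) =
     c^-1 * ((1 - t) * M * opnorm T) * c^-1 by ring.
  rewrite ler_pM ?opnorm_ge0// (le_trans (opnormM _ _))//.
  rewrite ler_pM ?opnorm_ge0// opnormZ ler_wpM2r ?opnorm_ge0//.
  rewrite rnormM rnormC ger0_norm ?subr_ge0//.
  by rewrite ler_wpM2l ?subr_ge0.
pose n := (2 ^ k)%N; have n0 : (0 < n)%N by rewrite expn_gt0.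
(* As [u^n = -1], the induction hypothesis at [u * w] inverts [1 + (w T)^n]; [|u| = 1] keeps [u * w]
   in the disk, so the Lipschitz constant is the same. *)
pose u : R[i] := n.-root (-1); have un : u ^+ n = -1 by rewrite rootCK.
have u1 : rnorm u = 1.
  apply/eqP; rewrite -(@pexpr_eq1 _ _ n) ?rnorm_ge0// -rnormX un rnormN.
  by rewrite rnorm1.
have uwM : rnorm (u * w) <= M by rewrite rnormM u1 mul1r.
have [V1 [V1' [h1 h1' d1]]] := IHk w t wM t01.
have [V2 [V2' [h2 h2' d2]]] := IHk (u * w) t uwM t01.
have neg (z : R[i]) : 1 - ((u * z) *: T) ^+ n = 1 + (z *: T) ^+ n.
  by rewrite !bop_exprZ exprMn un mulN1r scaleNr opprK.
rewrite -/n neg in h2; rewrite -/n mulrCA neg in h2'.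
exists ((2^-1 : R)%:C *: (V1 + V2)), ((2^-1 : R)%:C *: (V1' + V2')).
rewrite expnS mulnC !exprM !expr2; split; try exact: inverse_double.
rewrite -scalerBr opprD addrACA opnormZ rnormC ger0_norm//.
have := opnormD (V1 - V1') (V2 - V2').
move: (_ * (1 - t)) d1 d2 => D d1 d2 h.
by rewrite ler_pdivrMl//; lra.
Qed.

(** [V - 1 = A V], and [|V| <= 1 + |V| / 2] gives [|V| <= 2]. *)
Lemma inverse_near1 A V (e : R) : opnorm A <= e -> e <= 2^-1 ->
  inverse_of (1 - A) V -> opnorm (V - 1) <= 2 * e.
Proof.
move=> Ae e2 [AV _].
have VA : V - 1 = A * V.
  by rewrite -AV mulrBl mul1r opprB addrC subrK.
have V2 : opnorm V <= 2.
  have := opnormD (V - 1) 1; rewrite subrK VA.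
  have := opnormM A V; have := opnorm1 H; have := opnorm_ge0 V.
  by move: (opnorm V) (opnorm A) Ae => ? ? *; nra.
rewrite VA (le_trans (opnormM _ _))// mulrC.
by rewrite ler_pM ?opnorm_ge0.
Qed.

(** [A = (V - 1) - A (V - 1)] gives [|A| <= e + e |A|], and [e / (1 - e) <= 1/2] when [e <= 1/3]. *)
Lemma inverse_near1_opnorm A V (e : R) : opnorm (V - 1) <= e -> e <= 3^-1 ->
  inverse_of (1 - A) V -> opnorm A <= 2^-1.
Proof.
move=> Ve e3 [AV _].
have AE : A = (V - 1) - A * (V - 1).
  have VE : V - A * V = 1 by rewrite -AV mulrBl mul1r.
  by rewrite mulrBr mulr1 opprB -[in V - 1]VE subKr addrC subrK.
have := opnormB (V - 1) (A * (V - 1)); rewrite -AE.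
have := opnormM A (V - 1); have := opnorm_ge0 A; have := opnorm_ge0 (V - 1).
by move: (opnorm _) (opnorm A) Ve => ? ? *; nra.
Qed.

Lemma opnorm1_ge1 : (exists x : H, x != 0) -> 1 <= opnorm (1 : bop H).
Proof.
move=> [x x0]; have := opnorm_le 1 x; rewrite bop1E.
by rewrite -{1}(mul1r (rnorm x)) ler_pM2r// lt_def rnorm_ge0 rnorm_eq0 x0.
Qed.

(** An inverse [S] would give [1 = T^N S^N], hence [1 <= a (|S| + 1)] for every [a > 0]. This case
    is apart because Rickart's argument needs a circle of positive radius. *)
Lemma gelfand_radius0_spectrum T : (exists x : H, x != 0) -> gelfand_radius T = 0 -> spectrum T 0.
Proof.
move=> Hn0 T0; rewrite /spectrum /= scale0r subr0 => -[S [ST TS]].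
have c : GRing.comm T S by rewrite /GRing.comm ST TS.
have h a : 0 < a -> 1 <= a * (opnorm S + 1).
  move=> a0; have Ta : gelfand_radius T < a by rewrite T0.
  have [K K0 hK] := gelfand_radius_lt Ta.
  have S1 : 0 < opnorm S + 1 by rewrite ltr_wpDl ?opnorm_ge0.
  apply: (geometric_le (K := K)); first by rewrite mulr_gt0.
  move=> N; exists N => //; rewrite expr1n exprMn mulrA.
  rewrite (le_trans (opnorm1_ge1 Hn0))//.
  have -> : (1 : bop H) = T ^+ N * S ^+ N by rewrite -exprMn_comm// TS expr1n.
  rewrite (le_trans (opnormM _ _))// ler_pM ?opnorm_ge0//.
  rewrite (le_trans (opnormX _ _))// lerXn2r ?nnegrE ?opnorm_ge0 ?(ltW S1)//.
  by rewrite lerDl.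
have S1 : 0 < opnorm S + 1 by rewrite ltr_wpDl ?opnorm_ge0.
have := h (2^-1 / (opnorm S + 1)); rewrite divfK ?gt_eqF// divr_gt0//.
by move=> /(_ isT); lra.
Qed.

Lemma spectrum_ge_gelfand_radius T : (exists x : H, x != 0) ->
  exists2 z, spectrum T z & gelfand_radius T <= rnorm z.
Proof.
move=> Hn0; have [T0|Tn0] := eqVneq (gelfand_radius T) 0.
  by exists 0; rewrite ?T0 ?rnorm_ge0//; exact: gelfand_radius0_spectrum.
have nu0 : 0 < gelfand_radius T by rewrite lt_def Tn0 gelfand_radius_ge0.
apply: contrapT => none.
have out z : gelfand_radius T <= rnorm z -> invertible (T - z *: (1 : bop H)).
  by move=> Tz; apply: contrapT => sz; apply: none; exists z.
pose M := (gelfand_radius T)^-1; have M0 : 0 < M by rewrite invr_gt0.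
(* Under [z = w^-1] the disk without 0 becomes the region [r <= |z|], with [r] the growth rate,
   assumed free of spectrum. *)
have hinv w : rnorm w <= M -> invertible (1 - w *: T).
  have [->|w0] := eqVneq w 0.
    by move=> _; exists 1; rewrite scale0r subr0 !mulr1.
  have nw : 0 < rnorm w by rewrite lt_def rnorm_ge0 rnorm_eq0 w0.
  move=> wM; have /out[V [VT TV]] : gelfand_radius T <= rnorm w^-1.
    by rewrite rnormV -[gelfand_radius T]invrK lef_pV2 ?posrE.
  exists (- w^-1 *: V).
  have -> : 1 - w *: T = - w *: (T - w^-1 *: (1 : bop H)).
    rewrite scaleNr scalerBr scalerA.
    by rewrite (mulfV w0) scale1r opprB.
  rewrite !bopZMl !bopZMr !scalerA VT TV.
  by rewrite !mulrNN (mulVf w0) (mulfV w0) scale1r.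
have [c c0 hc] := resolvent_uniform_below hinv.
pose D := c^-1 * c^-1 * opnorm T * M.
have D0 : 0 <= D by rewrite !mulr_ge0 ?opnorm_ge0 ?invr_ge0 ?(ltW c0) ?(ltW nu0).
have D60 : 0 < 6 * (D + 1) by rewrite mulr_gt0// ltr_wpDl.
(* With [t = 1 - s] the Lipschitz gap [D (1 - t)] is at most 1/6, and [s <= 1/6] keeps [t]
   positive. *)
have [s s0 sE] : exists2 s : R, 0 < s & s * (6 * (D + 1)) = 1.
  by exists (6 * (D + 1))^-1; rewrite ?invr_gt0// mulVf ?gt_eqF.
pose t := 1 - s.
have Dt : D * (1 - t) <= 6^-1 by rewrite /t; nra.
have t0 : 0 < t by rewrite /t; nra.
have t1 : t < 1 by rewrite /t; lra.
(* A rate strictly between [r] and [r / t]: then [q = t a / r < 1], and [(t M T)^n] tends to 0. *)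
pose a := (gelfand_radius T + gelfand_radius T / t) / 2.
have tnu : gelfand_radius T < gelfand_radius T / t by rewrite ltr_pdivlMr// gtr_pMr.
have Ta : gelfand_radius T < a by rewrite /a; lra.
have [K K0 hK] := gelfand_radius_lt Ta.
pose q := t * M * a.
have a0 : 0 < a by exact: lt_trans nu0 Ta.
have q0 : 0 <= q := mulr_ge0 (mulr_ge0 (ltW t0) (ltW M0)) (ltW a0).
have q1 : q < 1.
  rewrite /q -mulrA mulrC -ltr_pdivlMr// div1r -ltr_pdivlMl//.
  by rewrite /M invrK /a; lra.
(* The constants add up: [|V' - 1| <= 2/12], then [|V - 1| <= 1/6 + 1/6 = 1/3], so
   [|(M T)^n| <= 1/2], whereas [M^n |T^n| >= M^n r^n = 1]. *)
have [k hk] : exists k, K * q ^+ (2 ^ k) <= 12^-1.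
  have K1 : 0 < (12 * K)^-1 by rewrite invr_gt0 mulr_gt0.
  have nq : `|q| < 1 by rewrite ger0_norm.
  have /cvgrPdist_lt/(_ _ K1)[N _ hN] := cvg_expr nq.
  exists N; have := hN (2 ^ N)%N (ltnW (ltn_expl N (isT : (1 < 2)%N))).
  rewrite /= sub0r normrN ger0_norm ?exprn_ge0// => /ltW.
  by rewrite invfM ler_pdivlMr// mulrC.
have MC : rnorm M%:C <= M by rewrite rnormC ger0_norm// ltW.
have t01 : 0 <= t <= 1 by rewrite !ltW.
have [V [V' [hV hV' dV]]] := resolvent_lipschitz c0 hinv hc k MC t01.
pose n := (2 ^ k)%N; have n0 : (0 < n)%N by rewrite expn_gt0.
have V'1 : opnorm (V' - 1) <= 2 * 12^-1.
  apply: inverse_near1 hV'; last by lra.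
  apply: le_trans hk; rewrite bop_exprZ opnormZ rnormX -realcM rnormC.
  rewrite ger0_norm ?mulr_ge0 ?(ltW t0) ?(ltW M0)//.
  rewrite /q [in leRHS]exprMn [leRHS]mulrCA ler_wpM2l ?hK// exprn_ge0//.
  by rewrite mulr_ge0 ?ltW.
have V1 : opnorm (V - 1) <= 3^-1.
  rewrite (le_trans (opnorm_triangle _ V' _))//.
  by move: dV; rewrite -/D; lra.
have := inverse_near1_opnorm V1 (lexx _) hV.
rewrite bop_exprZ opnormZ rnormX rnormC ger0_norm ?(ltW M0)// => h.
have := gelfand_radius_le_opnormX T n0; rewrite -/n in h.
have Mn : 0 < M ^+ n by rewrite exprn_gt0.
move=> /(ler_wpM2l (ltW Mn)); rewrite -exprMn /M mulVf ?gt_eqF// expr1n.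
by move: h; rewrite /M; lra.
Qed.

Lemma spectral_radiusE T : (exists x : H, x != 0) -> spectral_radius T = gelfand_radius T.
Proof.
move=> Hn0; have [z Tz nz] := spectrum_ge_gelfand_radius T Hn0; apply/le_anti/andP; split.
  apply: ge_sup; first by exists (rnorm z); exists z.
  by move=> _ [w Tw <-]; exact: spectrum_le_gelfand_radius.
apply: (le_trans nz); apply: ub_le_sup; last by exists z.
by exists (gelfand_radius T) => _ [w Tw <-]; exact: spectrum_le_gelfand_radius.
Qed.

End Rickart.

(** * Functional calculus of self-adjoint operators *)

Section PolynomialCalculus.
Variables (R : realType) (H : hilbertType R).
Implicit Types (x y : H) (z w : R[i]) (S T A B V : bop H) (p q : {poly R[i]}).

(** Complex coefficients, unlike [op_horner]: spectral mapping splits polynomials into linear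
    factors over [R[i]]. *)
Definition cpoly p A : bop H := \sum_(i < size p) p`_i *: A ^+ i.

Lemma cpoly_wide p A n : (size p <= n)%N -> cpoly p A = \sum_(i < n) p`_i *: A ^+ i.
Proof.
move=> pn; rewrite /cpoly (big_ord_widen n (fun i => p`_i *: A ^+ i)) ?big_mkcond//.
apply: eq_bigr => i _; case: ltnP => // pi.
by rewrite nth_default// scale0r.
Qed.

Lemma cpolyD p q A : cpoly (p + q) A = cpoly p A + cpoly q A.
Proof.
pose n := maxn (size p) (size q).
rewrite (@cpoly_wide (p + q) A n) ?size_polyD// (@cpoly_wide p A n) ?leq_maxl//.
rewrite (@cpoly_wide q A n) ?leq_maxr// -big_split/=.
by apply: eq_bigr => i _; rewrite coefD scalerDl.
Qed.

Lemma cpolyC z A : cpoly z%:P A = z *: (1 : bop H).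
Proof.
rewrite (@cpoly_wide _ _ 1) ?size_polyC; last by case: (z != 0).
by rewrite big_ord1 coefC eqxx expr0.
Qed.

Lemma cpolyZ z p A : cpoly (z *: p) A = z *: cpoly p A.
Proof.
rewrite (@cpoly_wide (z *: p) A (size p)) ?size_scale_leq// scaler_sumr.
by apply: eq_bigr => i _; rewrite coefZ scalerA.
Qed.

Lemma cpolyMX p A : cpoly (p * 'X) A = cpoly p A * A.
Proof.
rewrite (@cpoly_wide (p * 'X) A (size p).+1).
  rewrite big_ord_recl coefMX eqxx scale0r add0r mulr_suml.
  by apply: eq_bigr => i _; rewrite coefMX /= bopZMl exprSr.
by rewrite (leq_trans (size_polyMleq _ _))// size_polyX addn2.
Qed.

Lemma cpolyX A : cpoly 'X A = A.
Proof. by rewrite -['X]mul1r cpolyMX cpolyC scale1r mul1r. Qed.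

Lemma cpolyM p q A : cpoly (p * q) A = cpoly p A * cpoly q A.
Proof.
elim/poly_ind: p => [|p c IHp].
  by rewrite mul0r -[0]/(0%:P) cpolyC !scale0r mul0r.
rewrite mulrDl -mulrA ['X * q]mulrC mulrA cpolyD cpolyMX IHp mul_polyC cpolyZ.
rewrite cpolyD cpolyMX cpolyC mulrDl bopZMl mul1r; congr (_ + _).
rewrite -!mulrA; congr (_ * _).
suff : GRing.comm A (cpoly q A) by move=> ->.
apply: commr_sum => i _; rewrite /GRing.comm bopZMl bopZMr.
by rewrite -exprS exprSr.
Qed.

Lemma op_hornerE (p : {poly R}) A : op_horner p A = cpoly (map_poly (real_complex R) p) A.
Proof.
rewrite /op_horner /cpoly size_map_poly; apply: eq_bigr => i _.
by rewrite coef_map.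
Qed.

Lemma op_hornerM (p q : {poly R}) A : op_horner (p * q) A = op_horner p A * op_horner q A.
Proof. by rewrite !op_hornerE rmorphM cpolyM. Qed.

Lemma op_hornerB (p q : {poly R}) A : op_horner (p - q) A = op_horner p A - op_horner q A.
Proof.
rewrite !op_hornerE rmorphB cpolyD -scaleN1r cpolyZ scaleN1r.
by [].
Qed.

Lemma op_hornerX A : op_horner 'X A = A.
Proof. by rewrite op_hornerE map_polyX cpolyX. Qed.

Lemma invertibleM S T : invertible S -> invertible T -> invertible (S * T).
Proof.
move=> [V [VS SV]] [W [WT TW]]; exists (W * V); split.
  by rewrite mulrA -(mulrA W) VS mulr1.
by rewrite mulrA -(mulrA S) TW mulr1.
Qed.

Lemma invertibleZ z S : z != 0 -> invertible S -> invertible (z *: S).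
Proof.
move=> z0 [V [VS SV]]; exists (z^-1 *: V).
by rewrite !bopZMl !bopZMr !scalerA VS SV (mulVf z0) (mulfV z0) scale1r.
Qed.

(** If no root of [p - z] were in the spectrum of [A], [p(A) - z] would be a product of invertible
    factors. *)
Lemma spectrum_cpoly A p z : (exists x : H, x != 0) -> spectrum (cpoly p A) z ->
  exists2 w, spectrum A w & p.[w] = z.
Proof.
(* When [p] is the constant [z], any point of the spectrum serves, and one exists. *)
move=> Hn0 sz; have [p0|p0] := eqVneq (p - z%:P) 0.
  have [w sw _] := spectrum_ge_gelfand_radius A Hn0; exists w => //.
  by move/eqP: p0; rewrite subr_eq0 => /eqP ->; rewrite hornerC.
have [r pr] := closed_field_poly_normal (p - z%:P).
apply: contrapT => none; apply: sz.
have -> : cpoly p A - z *: (1 : bop H) = cpoly (p - z%:P) A.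
  by rewrite cpolyD -polyCN cpolyC scaleNr.
have out w : w \in r -> invertible (A - w *: (1 : bop H)).
  move=> wr; apply: contrapT => sw; apply: none; exists w => //.
  have : root (p - z%:P) w by rewrite pr rootZ ?lead_coef_eq0// root_prod_XsubC.
  by rewrite rootE hornerD hornerN hornerC subr_eq0 => /eqP.
rewrite pr cpolyZ; apply: invertibleZ; first by rewrite lead_coef_eq0.
elim: r out {pr} => [|w r IHr] out.
  by rewrite big_nil cpolyC scale1r; exists 1; rewrite mulr1.
rewrite big_cons cpolyM cpolyD -polyCN cpolyC cpolyX scaleNr.
apply: invertibleM; first by apply: out; rewrite mem_head.
by apply: IHr => v vr; apply: out; rewrite inE vr orbT.
Qed.

Lemma selfadjointX A n : selfadjoint A -> selfadjoint (A ^+ n).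
Proof.
move=> sA; elim: n => [|n IHn] x y; first by rewrite expr0.
by rewrite {1}exprSr exprS !bopME IHn sA.
Qed.

Lemma selfadjoint_horner (p : {poly R}) A : selfadjoint A -> selfadjoint (op_horner p A).
Proof.
move=> sA; rewrite /op_horner; elim/big_ind: _ => [x y|S T sS sT x y|i _ x y].
- by rewrite inner0l inner0r.
- by rewrite !bopDE innerDl innerDr sS sT.
by rewrite !bopZE innerZl innerZr conjc_real selfadjointX.
Qed.

Lemma opnorm_sqr_le B (c : R) : 0 <= c ->
  (forall x, rnorm (B x) ^+ 2 <= c * rnorm x ^+ 2) -> opnorm B ^+ 2 <= c.
Proof.
move=> c0 hc; rewrite -(sqr_sqrtr c0).
rewrite ler_pXn2r ?nnegrE ?opnorm_ge0 ?sqrtr_ge0//.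
apply: opnorm_ub; first by rewrite sqrtr_ge0.
move=> x; rewrite -(ler_pXn2r (n := 2)) ?nnegrE ?mulr_ge0 ?rnorm_ge0 ?sqrtr_ge0//.
by rewrite exprMn sqr_sqrtr.
Qed.

Lemma opnorm_selfadjoint_sqr B : selfadjoint B -> opnorm B ^+ 2 <= opnorm (B ^+ 2).
Proof.
move=> sB; apply: opnorm_sqr_le => [|x]; first exact: opnorm_ge0.
rewrite rnorm_sqr -sB -bopME -expr2 (le_trans (ler_norm _))//.
rewrite (le_trans (rnorm_Re _))// (le_trans (cauchy_schwarz _ _))//.
by rewrite expr2 mulrA ler_wpM2r ?rnorm_ge0 ?opnorm_le.
Qed.

(** [|B|^2 <= |B^2|] iterates to [|B|^n <= |B^n|] for [n] a power of 2, enough for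
    [geometric_le]. *)
Lemma gelfand_radius_selfadjoint B : selfadjoint B -> opnorm B <= gelfand_radius B.
Proof.
move=> sB.
have pow k : opnorm B ^+ (2 ^ k) <= opnorm (B ^+ (2 ^ k)).
  elim: k => [|k IHk]; first by rewrite expn0 !expr1.
  rewrite expnS mulnC !exprM (le_trans _ (opnorm_selfadjoint_sqr _))//.
    by rewrite ler_pXn2r ?nnegrE ?exprn_ge0 ?opnorm_ge0.
  exact: selfadjointX.
apply: lb_le_inf; first exact: (growth_has_inf B).1.
move=> a [a0 [K hK]]; apply: (geometric_le (K := K)) => // N.
by exists (2 ^ N)%N; [exact/ltnW/ltn_expl | exact: le_trans (pow N) (hK _)].
Qed.

(** The norm of [p(A)] is at most its growth rate, which its spectrum reaches; spectral mapping
    brings that point back to the spectrum of [A]. *)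
Lemma op_horner_le (p : {poly R}) A : (exists x : H, x != 0) -> selfadjoint A ->
  exists2 t : R, spectrum A t%:C & opnorm (op_horner p A) <= `|p.[t]|.
Proof.
move=> Hn0 sA.
have [z sz zB] := spectrum_ge_gelfand_radius (op_horner p A) Hn0.
rewrite op_hornerE in sz; have [w sw wz] := spectrum_cpoly Hn0 sz.
have wt := spectrum_selfadjoint sA sw; exists (complex.Re w); first by rewrite -wt.
rewrite (le_trans (gelfand_radius_selfadjoint (selfadjoint_horner _ sA)))//.
rewrite (le_trans zB)// -wz wt.
have -> : (complex.Re w)%:C = real_complex R (complex.Re w) by [].
by rewrite horner_map /= rnormC.
Qed.

End PolynomialCalculus.

(** * Continuous functional calculus *)

Section FunctionalCalculus.
Variables (R : realType) (H : hilbertType R).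
Hypothesis Hn0 : exists x : H, x != 0.
Implicit Types (x y : H) (A B C : bop H) (p q : {poly R}) (f g : R -> R).

Lemma cfc_approx A f B : is_cfc A f B -> forall e : R, 0 < e ->
  exists p, (forall t, spectrum A t%:C -> `|p.[t] - f t| <= e) /\
    opnorm (op_horner p A - B) <= e.
Proof.
move=> [p [pf /cvgrPdist_lt pB]] e e0.
have [N _ hN] := pf e e0; have [M _ hM] := pB e e0.
exists (p (maxn N M)); split; first exact: hN (leq_maxl _ _).
have := hM _ (leq_maxr N M); rewrite /= sub0r normrN => /ltW.
by apply: le_trans; exact: ler_norm.
Qed.

(** With [cfc_approx], this trades the approximating sequence for one polynomial per tolerance. *)
Lemma approx_cfc A f B : (forall e : R, 0 < e ->
    exists p, (forall t, spectrum A t%:C -> `|p.[t] - f t| <= e) /\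
      opnorm (op_horner p A - B) <= e) ->
  is_cfc A f B.
Proof.
move=> h.
have /choice[p hp] n : exists p,
    (forall t, spectrum A t%:C -> `|p.[t] - f t| <= n.+1%:R^-1) /\
    opnorm (op_horner p A - B) <= n.+1%:R^-1.
  by apply: h; rewrite invr_gt0.
exists p; split=> [e e0|].
  have [N hN] := invS_le e0; exists N => // n /= Nn t st.
  exact: le_trans ((hp n).1 t st) (hN n Nn).
apply/cvgrPdist_le => e e0; have [N hN] := invS_le e0; exists N => // n /= Nn.
rewrite sub0r normrN ger0_norm ?opnorm_ge0//.
exact: le_trans (hp n).2 (hN n Nn).
Qed.

(** Two polynomials within [e / 4] of [f] on the spectrum are [e / 2] apart there, hence in norm by
    [op_horner_le]. *)
Lemma cfc_uniq A f B C : selfadjoint A -> is_cfc A f B -> is_cfc A f C -> B = C.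
Proof.
move=> sA hB hC; apply/eqP; rewrite -subr_eq0; apply/eqP/opnorm_eps => e e0.
have e4 : 0 < e / 4 by rewrite divr_gt0.
have [p [pf pB]] := cfc_approx hB e4; have [q [qf qC]] := cfc_approx hC e4.
have [t st] := op_horner_le (p - q) Hn0 sA; rewrite op_hornerB hornerD hornerN.
have := pf t st; have := qf t st; rewrite distrC => qt pt.
have := ler_normD (p.[t] - f t) (f t - q.[t]); rewrite addrA subrK => pqt n1.
have := opnorm_triangle B (op_horner p A) C.
have := opnorm_triangle (op_horner p A) (op_horner q A) C.
by rewrite (opnormBC B (op_horner p A)); lra.
Qed.

Lemma cfc_opnorm A f B (c : R) : selfadjoint A -> is_cfc A f B ->
  (forall t, spectrum A t%:C -> `|f t| <= c) -> opnorm B <= c.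
Proof.
move=> sA hB fc; apply/ler_addgt0Pr => e e0.
have e2 : 0 < e / 2 by rewrite divr_gt0.
have [p [pf pB]] := cfc_approx hB e2.
have [t st pt] := op_horner_le p Hn0 sA.
have := pf t st; have := fc t st; have := ler_normD (p.[t] - f t) (f t).
rewrite subrK; have := opnorm_triangle B (op_horner p A) 0.
by rewrite !subr0 opnormBC; lra.
Qed.

Lemma cfcM A f g B C (F G : R) : selfadjoint A ->
  (forall t, spectrum A t%:C -> `|f t| <= F) ->
  (forall t, spectrum A t%:C -> `|g t| <= G) ->
  is_cfc A f B -> is_cfc A g C -> is_cfc A (fun t => f t * g t) (B * C).
Proof.
move=> sA fF gG hB hC; apply: approx_cfc => e e0.
(* The zero polynomial only serves to provide a point of the spectrum, whence [0 <= F] and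
   [0 <= G]. *)
have [t st _] := op_horner_le 0 Hn0 sA.
have F0 : 0 <= F by exact: le_trans (fF t st).
have G0 : 0 <= G by exact: le_trans (gG t st).
(* One constant for [pq - fg = (p - f)(q - g) + f (q - g) + (p - f) g] and its operator analogue;
   its summand 1 pays for the first product, at most [d] because [d <= 1]. *)
pose D := F + G + opnorm B + opnorm C + 1.
have D0 : 0 < D by rewrite ltr_wpDl// !addr_ge0 ?opnorm_ge0.
have [d d0 [d1 dD]] : exists2 d : R, 0 < d & d <= 1 /\ d * D <= e.
  exists (Num.min 1 (e / D)); first by rewrite lt_min ltr01 divr_gt0.
  by rewrite -ler_pdivlMr// !ge_min !lexx orbT.
have [p [pf pB]] := cfc_approx hB d0; have [q [qf qC]] := cfc_approx hC d0.
have B0 := opnorm_ge0 B; have C0 := opnorm_ge0 C.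
exists (p * q); split=> [s ss|].
  rewrite hornerM (_ : _ - _ = (p.[s] - f s) * (q.[s] - g s) +
    (f s * (q.[s] - g s) + (p.[s] - f s) * g s)); last by ring.
  rewrite (le_trans (ler_normD _ _))//.
  apply: le_trans (lerD (lexx _) (ler_normD _ _)) _; rewrite !normrM.
  move: (pf s ss) (qf s ss) (fF s ss) (gG s ss).
  have := normr_ge0 (p.[s] - f s); have := normr_ge0 (q.[s] - g s).
  have := normr_ge0 (f s); have := normr_ge0 (g s).
  move: `|p.[s] - f s| `|q.[s] - g s| `|f s| `|g s| => P Q X Y *.
  apply: le_trans dD; rewrite /D.
  have : P * Q <= d * 1 by rewrite ler_pM//; lra.
  have : X * Q <= F * d by rewrite ler_pM.
  have : P * Y <= d * G by rewrite ler_pM.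
  have : 0 <= d * opnorm B by rewrite mulr_ge0// ltW.
  have : 0 <= d * opnorm C by rewrite mulr_ge0// ltW.
  by lra.
rewrite op_hornerM; set P := op_horner p A in pB *; set Q := op_horner q A in qC *.
have -> : P * Q - B * C = (P - B) * (Q - C) + (B * (Q - C) + (P - B) * C).
  by rewrite addrA -mulrDl subrK mulrBr mulrBl addrA subrK.
rewrite (le_trans (opnormD _ _))//.
apply: le_trans (lerD (lexx _) (opnormD _ _)) _.
have h1 := opnormM (P - B) (Q - C); have h2 := opnormM B (Q - C).
have h3 := opnormM (P - B) C.
have P0 := opnorm_ge0 (P - B); have Q0 := opnorm_ge0 (Q - C).
apply: le_trans dD; rewrite /D.
have : opnorm (P - B) * opnorm (Q - C) <= d * 1 by rewrite ler_pM//; lra.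
have : opnorm B * opnorm (Q - C) <= opnorm B * d by rewrite ler_pM.
have : opnorm (P - B) * opnorm C <= d * opnorm C by rewrite ler_pM.
have : 0 <= d * F by rewrite mulr_ge0// ltW.
have : 0 <= d * G by rewrite mulr_ge0// ltW.
by lra.
Qed.

Lemma cfc_id A : is_cfc A id A.
Proof.
apply: approx_cfc => e e0; exists 'X; split=> [t _|].
  by rewrite hornerX subrr normr0 ltW.
by rewrite op_hornerX subrr opnorm0 ltW.
Qed.

Lemma cfc_ext A f g B : (forall t, spectrum A t%:C -> f t = g t) ->
  is_cfc A f B -> is_cfc A g B.
Proof.
move=> fg hB; apply: approx_cfc => e /(cfc_approx hB)[p [pf pB]].
by exists p; split=> // t st; rewrite -fg// pf.
Qed.

Lemma cfc_selfadjoint A f B : selfadjoint A -> is_cfc A f B -> selfadjoint B.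
Proof.
move=> sA hB x y; apply/eqP; rewrite -subr_eq0; apply/eqP/rnorm_eps => e e0.
have D0 : 0 < 2 * (rnorm x * rnorm y) + 1.
  by rewrite ltr_wpDl// !mulr_ge0 ?rnorm_ge0.
have [p [_ pB]] := cfc_approx hB (divr_gt0 e0 D0).
set P := op_horner p A in pB; have sP : selfadjoint P by exact: selfadjoint_horner.
have -> : '[B x, y] - '[x, B y] = '[x, (P - B) y] - '[(P - B) x, y].
  by rewrite !bopBE innerBl innerBr sP; ring.
rewrite (le_trans (rnormB _ _))//.
have h1 := cauchy_schwarz x ((P - B) y); have h2 := cauchy_schwarz ((P - B) x) y.
have h3 := ler_wpM2l (rnorm_ge0 x) (opnorm_le (P - B) y).
have h4 := ler_wpM2r (rnorm_ge0 y) (opnorm_le (P - B) x).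
apply: (@le_trans _ _ (opnorm (P - B) * (2 * (rnorm x * rnorm y) + 1))).
  by have := opnorm_ge0 (P - B); lra.
by rewrite -ler_pdivlMr.
Qed.

Lemma cfc_exists A f : selfadjoint A -> (forall e : R, 0 < e ->
    exists p, forall t, spectrum A t%:C -> `|p.[t] - f t| <= e) ->
  exists B, is_cfc A f B.
Proof.
move=> sA h.
have /choice[p hp] n : exists p, forall t, spectrum A t%:C ->
    `|p.[t] - f t| <= n.+1%:R^-1.
  by apply: h; rewrite invr_gt0.
have [e e0|B hB] := @bop_complete _ _ (fun n => op_horner (p n) A).
  have e2 : 0 < e / 2 by rewrite divr_gt0.
  have [N hN] := invS_le e2; exists N => m n Nm Nn.
  rewrite -op_hornerB; have [t st] := op_horner_le (p m - p n) Hn0 sA.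
  move/le_trans; apply; rewrite hornerD hornerN.
  have := le_trans (hp n t st) (hN _ Nn); have := le_trans (hp m t st) (hN _ Nm).
  rewrite (distrC (p n).[t]).
  have := ler_normD ((p m).[t] - f t) (f t - (p n).[t]); rewrite addrA subrK.
  by lra.
exists B; apply: approx_cfc => e e0.
have [N hN] := invS_le e0; have [M hM] := hB e e0.
exists (p (maxn N M)); split=> [t st|]; last exact: hM (leq_maxr _ _).
exact: le_trans (hp _ t st) (hN _ (leq_maxl _ _)).
Qed.

End FunctionalCalculus.

(** * Bernstein polynomials *)

Section Bernstein.
Variable R : realType.
Implicit Types (f g : nat -> R) (n : nat) (t : R).

(* [(bernstein n f).[t]] is the mean of [f] under the binomial law of
   parameters [n] and [t]. *)
Fixpoint bernstein n f : {poly R} :=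
  if n is n'.+1 then 'X * bernstein n' (fun k => f k.+1) + (1 - 'X) * bernstein n' f
  else (f 0%N)%:P.

Lemma bernsteinS n f t : (bernstein n.+1 f).[t] =
  t * (bernstein n (fun k => f k.+1)).[t] + (1 - t) * (bernstein n f).[t].
Proof. by rewrite /= hornerD !hornerM hornerD hornerN hornerX hornerC. Qed.

Lemma bernstein_linear n f g (a b t : R) :
  (bernstein n (fun k => a * f k + b * g k)).[t] =
  a * (bernstein n f).[t] + b * (bernstein n g).[t].
Proof.
elim: n f g => [|n IHn] f g; first by rewrite /= !hornerC.
by rewrite !bernsteinS !IHn; ring.
Qed.

Lemma bernstein_le n f g t : 0 <= t <= 1 -> (forall k, (k <= n)%N -> f k <= g k) ->
  (bernstein n f).[t] <= (bernstein n g).[t].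
Proof.
move=> /andP[t0 t1]; elim: n f g => [|n IHn] f g fg; first by rewrite /= !hornerC fg.
by rewrite !bernsteinS lerD// ler_wpM2l ?subr_ge0// IHn// => k kn; rewrite fg// ltnW.
Qed.

Lemma bernstein_cst n (c t : R) : (bernstein n (fun=> c)).[t] = c.
Proof.
elim: n => [|n IHn]; first by rewrite /= hornerC.
by rewrite bernsteinS IHn; ring.
Qed.

(** Second moment of a shifted binomial variable: squared mean plus variance. The offset [c] is
    general because the induction replaces it by [c + 1]. *)
Lemma bernstein_sqr n (c t : R) : (bernstein n (fun k => (k%:R + c) ^+ 2)).[t] =
  (n%:R * t + c) ^+ 2 + n%:R * (t * (1 - t)).
Proof.
elim: n c => [|n IHn] c; first by rewrite /= hornerC !mul0r !add0r addr0.
rewrite bernsteinS IHn.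
have -> : (fun k => (k.+1%:R + c) ^+ 2) = (fun k => (k%:R + (c + 1)) ^+ 2) :> (nat -> R).
  by apply/funext => k; rewrite -natr1 -addrA [1 + c]addrC.
by rewrite IHn -natr1; ring.
Qed.

(** Chebyshev's argument: the deviation from [f t] is dominated by a quadratic of mean
    [e + C t (1 - t) / n]. *)
Lemma bernstein_approx (f : R -> R) (e C : R) n t : (0 < n)%N -> 0 <= t <= 1 ->
  (forall u, 0 <= u <= 1 -> `|f u - f t| <= e + C * (u - t) ^+ 2) -> 0 <= C ->
  `|(bernstein n (fun k => f (k%:R / n%:R))).[t] - f t| <= e + C / n%:R.
Proof.
move=> n0 t01 hf C0; have n1 : 0 < n%:R :> R by rewrite ltr0n.
have ne : n%:R != 0 :> R by rewrite gt_eqF.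
set b := (bernstein n _).[t].
pose g k := 1 * e + (C / n%:R ^+ 2) * (k%:R + - (n%:R * t)) ^+ 2 : R.
have gt : (bernstein n g).[t] <= e + C / n%:R.
  rewrite /g (bernstein_linear n (fun=> e)) bernstein_cst bernstein_sqr subrr expr0n add0r mul1r.
  rewrite lerD2l (_ : _ * _ = C / n%:R * (t * (1 - t))); last by field.
  by move/andP: t01 => [t0 t1]; rewrite ler_piMr ?divr_ge0// ?(ltW n1)//; nra.
have fg k : (k <= n)%N -> `|f (k%:R / n%:R) - f t| <= g k.
  move=> kn; rewrite (le_trans (hf _ _))//.
    by rewrite divr_ge0 ?ler0n//= ler_pdivrMr// mul1r ler_nat.
  by rewrite /g mul1r le_eqVlt; apply/orP; left; apply/eqP; field.
rewrite ler_norml; apply/andP; split.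
  have : (bernstein n (fun k => -1 * g k + 1 * f t)).[t] <= b.
    apply: bernstein_le => // k /fg; rewrite ler_norml; lra.
  by rewrite (bernstein_linear n g (fun=> f t)) bernstein_cst; lra.
have : b <= (bernstein n (fun k => 1 * g k + 1 * f t)).[t].
  apply: bernstein_le => // k /fg; rewrite ler_norml; lra.
by rewrite (bernstein_linear n g (fun=> f t)) bernstein_cst; lra.
Qed.

End Bernstein.

(** * Powers of positive operators *)

Section PowerApproximation.
Variable R : realType.
Implicit Types s t u v : R.

(** For [s <= 1], a ratio in [[0, 1]] is at most its [s]-th power; the ratios [u / (u + v)] and
    [v / (u + v)] sum to 1. *)
Lemma powR_subadditive s u v : 0 < s <= 1 -> 0 <= u -> 0 <= v ->
  (u + v) `^ s <= u `^ s + v `^ s.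
Proof.
move=> /andP[s0 s1] u0 v0; have [uv|uv] := leP (u + v) 0.
  by rewrite (_ : u + v = 0) ?powR0 ?gt_eqF ?addr_ge0 ?powR_ge0//; lra.
have ratio w : 0 <= w -> w <= u + v -> w / (u + v) * (u + v) `^ s <= w `^ s.
  move=> w0 wuv; have [->|wn0] := eqVneq w 0; first by rewrite !mul0r powR_ge0.
  have wp : 0 < w by rewrite lt_def wn0.
  have -> : w `^ s = (w / (u + v)) `^ s * (u + v) `^ s.
    by rewrite -powRM ?divr_ge0 ?(ltW uv)// divfK// gt_eqF.
  rewrite ler_wpM2r ?powR_ge0// ger1_powR// divr_gt0//=.
  by rewrite ler_pdivrMr// mul1r.
have := ratio u u0; have := ratio v v0.
rewrite lerDl lerDr => /(_ u0) hv /(_ v0) hu.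
apply: le_trans (lerD hu hv).
by rewrite -mulrDl -mulrDl mulfV ?mul1r// gt_eqF.
Qed.

Lemma powR_holder s u v : 0 < s <= 1 -> 0 <= u -> 0 <= v ->
  `|u `^ s - v `^ s| <= `|u - v| `^ s.
Proof.
move=> s01 u0 v0; wlog uv : u v u0 v0 / v <= u.
  move=> h; have [/h|/ltW /h] := leP v u; first exact.
  by rewrite distrC (distrC u); exact.
have uv0 : 0 <= u - v by rewrite subr_ge0.
have s0 : 0 <= s by case/andP: s01 => /ltW.
rewrite !ger0_norm//; last by rewrite subr_ge0 ge0_ler_powR.
by rewrite lerBlDr -{1}(subrK v u) powR_subadditive.
Qed.

(** Within [d = e^(1/s)] the Holder bound gives [e]; beyond it the difference, at most 1, is
    absorbed by [(u - v)^2 / d^2]. *)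
Lemma powR_quadratic s (e : R) : 0 < s <= 1 -> 0 < e ->
  exists2 C : R, 0 <= C & forall u v, 0 <= u <= 1 -> 0 <= v <= 1 ->
    `|u `^ s - v `^ s| <= e + C * (u - v) ^+ 2.
Proof.
move=> s01 e0; have /andP[s0 s1] := s01; pose d := e `^ s^-1.
have d0 : 0 < d by rewrite powR_gt0.
have ds : d `^ s = e by rewrite -powRrM mulVf ?gt_eqF// powRr1// ltW.
exists (d ^+ 2)^-1; first by rewrite invr_ge0 sqr_ge0.
move=> u v /andP[u0 u1] /andP[v0 v1]; rewrite (le_trans (powR_holder s01 u0 v0))//.
have [uvd|uvd] := leP `|u - v| d.
  apply: (@le_trans _ _ e); last by rewrite lerDl mulr_ge0 ?invr_ge0 ?sqr_ge0.
  by rewrite -ds ge0_ler_powR ?nnegrE ?(ltW s0) ?(ltW d0).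
apply: (@le_trans _ _ 1).
  have <- : 1 `^ s = 1 :> R by rewrite powR1.
  rewrite ge0_ler_powR ?nnegrE ?(ltW s0)//.
  by rewrite ler_norml; apply/andP; split; lra.
have : 1 <= (d ^+ 2)^-1 * (u - v) ^+ 2; last by lra.
rewrite -(real_normK (num_real (u - v))) ler_pdivlMl ?exprn_gt0// mulr1.
by rewrite ler_pXn2r ?nnegrE ?(ltW d0)// ltW.
Qed.

Lemma powR_approx s (M e : R) : 0 <= s <= 1 -> 0 < M -> 0 < e ->
  exists p : {poly R}, forall t, 0 <= t <= M -> `|p.[t] - t `^ s| <= e.
Proof.
move=> /andP[]; rewrite le_eqVlt => /orP[/eqP <- _ _ e0|s0 s1 M0 e0].
  by exists 1 => t _; rewrite powRr0 hornerC subrr normr0 ltW.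
have s01 : 0 < s <= 1 by rewrite s0.
have Ms : 0 < M `^ s by rewrite powR_gt0.
(* Half of the tolerance goes to [powR_quadratic] and half to [C / n], once divided by the factor
   [M^s] of the rescaling to [[0, 1]]. *)
pose d := e / M `^ s / 2; have d0 : 0 < d by rewrite !divr_gt0.
have [C C0 hC] := powR_quadratic s01 d0.
have [n hn] : exists n : nat, C * n.+1%:R^-1 <= d.
  have C1 : 0 < C + 1 by rewrite ltr_wpDl.
  have [N hN] := invS_le (divr_gt0 d0 C1); exists N.
  have := hN N (leqnn N); rewrite ler_pdivlMr//; apply: le_trans.
  by rewrite mulrDr mulr1 mulrC lerDl invr_ge0.
exists (M `^ s *: (bernstein n.+1 (fun k => (k%:R / n.+1%:R) `^ s) \Po (M^-1 *: 'X))).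
move=> t /andP[t0 tM]; rewrite hornerZ horner_comp hornerZ hornerX.
have u01 : 0 <= M^-1 * t <= 1.
  by rewrite mulr_ge0 ?invr_ge0 ?(ltW M0)//= ler_pdivrMl// mulr1.
have -> : t `^ s = M `^ s * (M^-1 * t) `^ s.
  by rewrite -powRM ?mulVKf ?gt_eqF// ?(ltW M0)//; case/andP: u01.
rewrite -mulrBr normrM (gtr0_norm Ms) -ler_pdivlMl//.
have := @bernstein_approx R (fun u => u `^ s) d C n.+1 _ isT u01
  (fun u hu => hC u _ hu u01) C0.
move/le_trans; apply; have -> : (M `^ s)^-1 * e = d + d.
  by rewrite /d; field; rewrite gt_eqF.
by rewrite lerD2l.
Qed.

End PowerApproximation.

Section Powers.
Variables (R : realType) (H : hilbertType R).
Hypothesis Hn0 : exists x : H, x != 0.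
Implicit Types (x y : H) (A B C T U : bop H) (s t : R).

Lemma spectrum_positive_le A t : positive A -> spectrum A t%:C -> 0 <= t <= opnorm A.
Proof.
move=> pA st; have t0 := spectrum_positive pA st; rewrite t0.
by have := spectrum_le_opnorm st; rewrite rnormC ger0_norm.
Qed.

Lemma oppow_cfc A s : positive A -> 0 <= s <= 1 ->
  is_cfc A (fun t => t `^ s) (oppow A s).
Proof.
move=> pA s01; apply: (xgetPex 0) => /=.
apply: cfc_exists => //; first by case: pA.
move=> e e0; have M0 : 0 < opnorm A + 1 by rewrite ltr_wpDl ?opnorm_ge0.
have [p hp] := powR_approx s01 M0 e0; exists p => t st; apply: hp.
by case/andP: (spectrum_positive_le pA st) => -> /=; lra.
Qed.

Lemma oppow_opnorm A s : positive A -> 0 <= s <= 1 ->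
  opnorm (oppow A s) <= opnorm A `^ s.
Proof.
move=> pA s01; apply: (cfc_opnorm Hn0 _ (oppow_cfc pA s01)); first by case: pA.
move=> t /(spectrum_positive_le pA)/andP[t0 tA].
rewrite ger0_norm ?powR_ge0// ge0_ler_powR ?nnegrE ?opnorm_ge0//.
by case/andP: s01.
Qed.

(** A single zero exponent is allowed, thanks to [0^0 = 1]; this covers the endpoints of
    [lambda]. *)
Lemma oppowD A s s' : positive A -> 0 <= s -> 0 <= s' -> 0 < s + s' <= 1 ->
  oppow A s * oppow A s' = oppow A (s + s').
Proof.
move=> pA s0 s0' /andP[ss0 ss1].
have h1 : 0 <= s <= 1 by rewrite s0/=; lra.
have h2 : 0 <= s' <= 1 by rewrite s0'/=; lra.
have h3 : 0 <= s + s' <= 1 by rewrite ltW.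
have sA : selfadjoint A by case: pA.
have bd r : 0 <= r <= 1 -> forall t, spectrum A t%:C -> `|t `^ r| <= opnorm A `^ r.
  move=> /andP[r0 _] t /(spectrum_positive_le pA)/andP[t0 tA].
  by rewrite ger0_norm ?powR_ge0// ge0_ler_powR ?nnegrE ?opnorm_ge0.
apply: (cfc_uniq Hn0 sA) (oppow_cfc pA h3).
apply: cfc_ext (cfcM Hn0 sA (bd _ h1) (bd _ h2) (oppow_cfc pA h1) (oppow_cfc pA h2)).
by move=> t _ /=; rewrite powRD// gt_eqF.
Qed.

Lemma oppow1 A : positive A -> oppow A 1 = A.
Proof.
move=> pA; have sA : selfadjoint A by case: pA.
apply: (cfc_uniq Hn0 sA) (cfc_id A).
apply: cfc_ext (oppow_cfc pA _); last by rewrite ler01 lexx.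
by move=> t /(spectrum_positive_le pA)/andP[t0 _]; rewrite powRr1.
Qed.

Lemma oppow_selfadjoint A s : positive A -> 0 <= s <= 1 -> selfadjoint (oppow A s).
Proof. by move=> pA s01; apply: cfc_selfadjoint (oppow_cfc pA s01); case: pA. Qed.

Lemma positive_sqr A : selfadjoint A -> positive (A * A).
Proof.
move=> sA; split=> [x y|x]; first by rewrite !bopME !sA.
by rewrite bopME sA -rnorm_sqr sqr_ge0.
Qed.

(** The square root is the square of the self-adjoint fourth root. *)
Lemma oppow_half_positive A : positive A -> positive (oppow A 2^-1).
Proof.
move=> pA; have s4 : 0 <= (4^-1 : R) <= 1 by lra.
rewrite (_ : 2^-1 = 4^-1 + 4^-1 :> R); last by field.
rewrite -oppowD//; first exact/positive_sqr/oppow_selfadjoint.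
by apply/andP; split; lra.
Qed.

Lemma adjointM_positive T : positive (adjoint T * T).
Proof.
split=> [x y|x]; rewrite !bopME.
  by rewrite -adjointE innerC -adjointE -innerC.
by rewrite inner_ReC -adjointE -rnorm_sqr sqr_ge0.
Qed.

Lemma opabs_positive T : positive (opabs T).
Proof. exact/oppow_half_positive/adjointM_positive. Qed.

Lemma opabs_sqr T : opabs T * opabs T = adjoint T * T.
Proof.
have pA := adjointM_positive T; rewrite oppowD ?invr_ge0//; last by lra.
by rewrite (_ : _ + _ = 1) ?oppow1//; field.
Qed.

(** Comes from [|T|^2 = adjoint T * T]; it makes [|T| y |-> T y] well defined and isometric. *)
Lemma rnorm_opabs T x : rnorm (opabs T x) = rnorm (T x).
Proof.
apply/eqP; rewrite -(@eqrXn2 _ 2) ?rnorm_ge0// !rnorm_sqr.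
have [sD _] := opabs_positive T.
by rewrite sD -bopME opabs_sqr bopME -adjointE.
Qed.

Lemma opnorm_opabs T : opnorm (opabs T) <= opnorm T.
Proof.
by apply: opnorm_ub; [exact: opnorm_ge0 | move=> x; rewrite rnorm_opabs opnorm_le].
Qed.

End Powers.

(** * Polar decomposition and the Aluthge transform *)

Section Polar.
Variables (R : realType) (H : hilbertType R).
Hypothesis Hn0 : exists x : H, x != 0.
Implicit Types (x y : H) (S T U : bop H).

Lemma kernel_closed T : closed_subspace [set x | T x = 0].
Proof.
split=> /= [|a x y Tx Ty|x h]; first exact: linear0.
  by rewrite bop_linearP Tx Ty scaler0 addr0.
apply: rnorm_eps => e e0; have T1 : 0 < opnorm T + 1 by rewrite ltr_wpDl ?opnorm_ge0.
have [m /= Tm] := h _ (divr_gt0 e0 T1); rewrite ler_pdivlMr// => xm.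
have := opnorm_le T (x - m); rewrite bop_linearB Tm subr0.
by have := rnorm_ge0 (x - m); lra.
Qed.

(** Subtracting from [x] its projection on the kernel leaves [U x] unchanged and does not lengthen
    [x]. *)
Lemma partial_isometry_opnorm U : partial_isometry U -> opnorm U <= 1.
Proof.
move=> Upi; apply: opnorm_ub => // x; rewrite mul1r.
have [p /= Up hp] := projection x (kernel_closed U).
have -> : U x = U (x - p) by rewrite bop_linearB Up subr0.
rewrite [rnorm (U _)]/rnorm Upi -/(rnorm _); last by move=> y Uy; exact: hp.
have := hp p Up; rewrite -{3}(subrK p x); exact: rnorm_le_pythagoras.
Qed.

Section PolarDecomposition.
Variable T : bop H.
Let D := opabs T.

Let Dsa : selfadjoint D. Proof. by case: (opabs_positive Hn0 T). Qed.

(* The graph of the polar isometry: [|T| y] goes to [T y], extended by continuity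
   to the closure of the range of [|T|], and [ker |T|] goes to 0. *)
Definition polar_graph x v := exists p k, [/\ x = p + k, D k = 0 &
  forall e : R, 0 < e -> exists y, rnorm (p - D y) <= e /\ rnorm (v - T y) <= e].

(** [p] is a limit of vectors [D y], orthogonal to the kernel of the self-adjoint [D], and
    [|v| = |p|] follows from [|T y| = |D y|]. *)
Lemma polar_graph_witness x v : polar_graph x v -> exists p k,
  [/\ x = p + k, D k = 0, '[p, k] = 0 & rnorm v = rnorm p].
Proof.
move=> [p [k [-> Dk h]]]; exists p, k; split=> //.
  apply: rnorm_eps => e e0.
  have k1 : 0 < rnorm k + 1 by rewrite ltr_wpDl ?rnorm_ge0.
  have [y [py _]] := h _ (divr_gt0 e0 k1).
  have -> : '[p, k] = '[p - D y, k] by rewrite innerBl Dsa Dk inner0r subr0.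
  rewrite (le_trans (cauchy_schwarz _ _))//.
  move: py; rewrite ler_pdivlMr//; apply: le_trans.
  by rewrite ler_wpM2l ?rnorm_ge0// lerDl.
have eps (a b : R) : (forall e : R, 0 < e -> a <= b + e) -> a <= b.
  by move=> ab; apply/ler_addgt0Pr.
apply/le_anti/andP; split; apply: eps => e e0.
  have [|y [py vy]] := h (e / 2); first by rewrite divr_gt0.
  have := rnorm_triangle v (T y) 0; have := rnorm_triangle (D y) p 0.
  by rewrite !subr0 rnorm_opabs// (rnormBC (D y)); lra.
have [|y [py vy]] := h (e / 2); first by rewrite divr_gt0.
have := rnorm_triangle (T y) v 0; have := rnorm_triangle p (D y) 0.
by rewrite !subr0 rnorm_opabs// (rnormBC (T y)); lra.
Qed.

Lemma polar_graph_le x v : polar_graph x v -> rnorm v <= 1 * rnorm x.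
Proof.
move=> /polar_graph_witness[p [k [-> _ pk ->]]]; rewrite mul1r.
exact: rnorm_le_pythagoras.
Qed.

Lemma polar_graph_linear (a : R[i]) x u y v :
  polar_graph x u -> polar_graph y v -> polar_graph (a *: x + y) (a *: u + v).
Proof.
move=> [p [k [-> Dk h]]] [q [l [-> Dl h']]].
exists (a *: p + q), (a *: k + l); split.
- by rewrite scalerDr addrACA.
- by rewrite bop_linearP Dk Dl scaler0 addr0.
move=> e e0; have a1 : 0 < rnorm a + 1 by rewrite ltr_wpDl ?rnorm_ge0.
have e1 := divr_gt0 e0 a1; have [w [pw uw]] := h _ e1; have [z [qz vz]] := h' _ e1.
have bound (c c' d d' : H) : rnorm (c - c') <= e / (rnorm a + 1) ->
    rnorm (d - d') <= e / (rnorm a + 1) ->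
    rnorm (a *: c + d - (a *: c' + d')) <= e.
  move=> hc hd; rewrite opprD addrACA -scalerBr (le_trans (rnormD _ _))// rnormZ.
  have -> : e = rnorm a * (e / (rnorm a + 1)) + e / (rnorm a + 1).
    by field; rewrite gt_eqF.
  by rewrite lerD// ler_wpM2l ?rnorm_ge0.
by exists (a *: w + z); rewrite !bop_linearP; split; exact: bound.
Qed.

(** [p] is the projection on [N], the closure of the range of [D]; when [D (y n)] tends to [p],
    [T (y n)] is Cauchy because [T] and [D] stretch vectors equally. *)
Lemma polar_graph_total x : exists v, polar_graph x v.
Proof.
pose N := [set p | forall e : R, 0 < e -> exists y, rnorm (p - D y) <= e].
have ND y : N (D y) by move=> e e0; exists y; rewrite subrr rnorm0 ltW.
have Ncl : closed_subspace N.
  split=> [|a p q Np Nq e e0|p h e e0].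
  - by have := ND 0; rewrite linear0.
  - have a1 : 0 < rnorm a + 1 by rewrite ltr_wpDl ?rnorm_ge0.
    have e1 := divr_gt0 e0 a1; have [w pw] := Np _ e1; have [z qz] := Nq _ e1.
    exists (a *: w + z); rewrite bop_linearP opprD addrACA -scalerBr.
    rewrite (le_trans (rnormD _ _))// rnormZ.
    have -> : e = rnorm a * (e / (rnorm a + 1)) + e / (rnorm a + 1).
      by field; rewrite gt_eqF.
    by rewrite lerD// ler_wpM2l ?rnorm_ge0.
  have e2 : 0 < e / 2 by rewrite divr_gt0.
  have [m Nm pm] := h _ e2; have [y my] := Nm _ e2; exists y.
  by have := rnorm_triangle p m (D y); lra.
have [p Np hp] := projection x Ncl.
have /choice[y hy] n : exists y, rnorm (p - D y) <= n.+1%:R^-1.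
  by apply: Np; rewrite invr_gt0.
have [e e0|v hv] := @rnorm_cauchy _ _ (fun n => T (y n)).
  have e2 : 0 < e / 2 by rewrite divr_gt0.
  have [M hM] := invS_le e2; exists M => m n Mm Mn.
  rewrite -bop_linearB -rnorm_opabs// bop_linearB.
  have := rnorm_triangle (D (y m)) p (D (y n)); rewrite (rnormBC (D (y m)) p) -/D.
  have := le_trans (hy m) (hM m Mm); have := le_trans (hy n) (hM n Mn).
  by lra.
exists v, p, (x - p); split; first by rewrite addrC subrK.
  (* [D (D (x - p))] lies in [N], to which [x - p] is orthogonal. *)
  by apply: inner_eq0; rewrite Dsa; apply: hp.
move=> e e0; have [M hM] := invS_le e0; have [M' hM'] := hv _ e0.
exists (y (maxn M M')); split; first exact: le_trans (hy _) (hM _ (leq_maxl _ _)).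
by rewrite rnormBC hM'// leq_maxr.
Qed.

Lemma polar_isometry_exists : exists U, [/\ partial_isometry U,
  forall x, U x = 0 <-> T x = 0 & T = U * opabs T].
Proof.
have [U hU] := bop_of_relation polar_graph_linear polar_graph_total polar_graph_le.
have uniq x v : polar_graph x v -> U x = v.
  move=> xv; have := polar_graph_linear (-1) (hU x) xv.
  rewrite !scaleN1r addNr => /polar_graph_le; rewrite rnorm0 mulr0 => h.
  apply/esym/eqP; rewrite -subr_eq0 addrC -rnorm_eq0 eq_le h.
  exact: rnorm_ge0.
have DT x : D x = 0 <-> T x = 0.
  split=> h; apply/eqP; rewrite -rnorm_eq0; apply/eqP.
    by rewrite -rnorm_opabs// -/D h rnorm0.
  by rewrite rnorm_opabs// h rnorm0.
have ker x : T x = 0 -> U x = 0.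
  move=> /DT Dx; apply: uniq; exists 0, x; rewrite add0r; split=> // e e0.
  by exists 0; rewrite !linear0 addr0 rnorm0 ltW.
exists U; split=> [x xU|x|].
- have [p [k [xpk Dk pk Up]]] := polar_graph_witness (hU x).
  (* [k] lies in the kernel of [U], to which [x] is orthogonal; as [p] is orthogonal to [k] too, [k]
     vanishes. *)
  have xk : '[x, k] = 0 by apply/xU/ker/DT.
  have k0 : k = 0.
    by apply: inner_eq0; move: xk; rewrite xpk innerDl pk add0r.
  by rewrite !rnormE Up xpk k0 addr0.
- split; last exact: ker.
  have [p [k [-> Dk _ Up]]] := polar_graph_witness (hU x).
  move=> U0; apply/DT; move: Up; rewrite U0 rnorm0 => /esym/eqP.
  by rewrite rnorm_eq0 => /eqP ->; rewrite add0r.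
apply: bop_eq => y; rewrite bopME; apply/esym/uniq; exists (D y), 0.
rewrite addr0 linear0; split=> // e e0; exists y.
by rewrite !subrr !rnorm0 ltW.
Qed.

End PolarDecomposition.

Lemma polar_isometryP T : [/\ partial_isometry (polar_isometry T),
  forall x, polar_isometry T x = 0 <-> T x = 0 & T = polar_isometry T * opabs T].
Proof. exact: (xgetPex 0 (polar_isometry_exists T)). Qed.

(** The factors have norms at most [t^lambda], 1 and [t^(1 - lambda)], with [t = opnorm T], and the
    exponents sum to 1. *)
Lemma opnorm_aluthge (lambda : R) T : 0 <= lambda <= 1 ->
  opnorm (aluthge lambda T) <= opnorm T.
Proof.
move=> l01; have l01' : 0 <= 1 - lambda <= 1 by move: l01; lra.
have pD := opabs_positive Hn0 T; have [Upi _ _] := polar_isometryP T.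
have pow s : 0 <= s <= 1 -> opnorm (oppow (opabs T) s) <= opnorm T `^ s.
  move=> s01; rewrite (le_trans (oppow_opnorm Hn0 pD s01))//.
  case/andP: s01 => s0 _.
  by rewrite ge0_ler_powR ?nnegrE ?opnorm_ge0 ?opnorm_opabs.
rewrite (le_trans (opnormM _ _))//.
have -> : opnorm T = opnorm T `^ lambda * opnorm T `^ (1 - lambda).
  rewrite -powRD; last by rewrite addrC subrK oner_eq0.
  by rewrite addrC subrK powRr1 ?opnorm_ge0.
rewrite ler_pM ?opnorm_ge0 ?pow// (le_trans (opnormM _ _))//.
rewrite -[leRHS]mulr1 ler_pM ?opnorm_ge0 ?pow//.
exact: partial_isometry_opnorm.
Qed.

(* [T = (U |T|^(1-l)) |T|^l] while [aluthge l T = |T|^l (U |T|^(1-l))]. *)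
Lemma gelfand_radius_aluthge (lambda : R) T : 0 <= lambda <= 1 ->
  gelfand_radius (aluthge lambda T) = gelfand_radius T.
Proof.
move=> l01; have l01' : 0 <= 1 - lambda <= 1 by move: l01; lra.
have pD := opabs_positive Hn0 T; have [_ _ TE] := polar_isometryP T.
rewrite /aluthge -mulrA gelfand_radius_comm -mulrA oppowD//.
- by rewrite subrK oppow1// -TE.
- by case/andP: l01'.
- by case/andP: l01.
by rewrite subrK ltr01 lexx.
Qed.

(** Each transform preserves the growth rate and does not increase the norm, so the bounds do not
    depend on [n]. *)
Lemma iter_aluthge (lambda : R) n T : 0 <= lambda <= 1 ->
  gelfand_radius T <= opnorm (iter n (aluthge lambda) T) <= opnorm T.
Proof.
move=> l01.
have -> : gelfand_radius T = gelfand_radius (iter n (aluthge lambda) T).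
  by elim: n => //= n IHn; rewrite gelfand_radius_aluthge.
rewrite gelfand_radius_le_opnorm; elim: n => //= n IHn.
exact: le_trans (opnorm_aluthge _ l01) IHn.
Qed.

End Polar.

(** * Convergence of the roots *)

Lemma root_cvg (R : realType) (u : nat -> R) (r : R) : 0 <= r ->
  (forall k, (0 < k)%N -> r ^+ k <= u k) ->
  (forall a, r < a -> exists2 K : R, 0 < K & forall k, u k <= K * a ^+ k) ->
  u k `^ k%:R^-1 @[k --> \oo] --> r.
Proof.
move=> r0 ur uK; apply/cvgrPdist_le => e e0.
(* As [r < a < r + e], eventually [K a^k <= (r + e)^k]: the constant [K] is absorbed. *)
pose a := r + e / 2; have ra : r < a by rewrite ltrDl divr_gt0.
have [K K0 hK] := uK a ra.
have re : 0 < r + e by rewrite ltr_wpDl.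
have q1 : `|a / (r + e)| < 1.
  rewrite ger0_norm ?divr_ge0 ?(ltW re)//; last by rewrite (le_trans r0)// ltW.
  by rewrite ltr_pdivrMr// mul1r /a; lra.
have K1 : 0 < K^-1 by rewrite invr_gt0.
have /cvgrPdist_lt/(_ _ K1)[N _ hN] := cvg_expr q1.
(* [k = 0] is left out: there the exponent is [0^-1 = 0], which takes no root. *)
exists (maxn 1 N) => // k; rewrite /= geq_max => /andP[k0 Nk].
have rk : 0 <= r ^+ k by rewrite exprn_ge0.
have root (v : R) : 0 <= v -> (v ^+ k) `^ k%:R^-1 = v.
  by move=> v0; rewrite -powR_mulrn// -powRrM mulfV ?powRr1// pnatr_eq0 -lt0n.
have kinv : 0 <= k%:R^-1 :> R by rewrite invr_ge0.
have lo : r <= u k `^ k%:R^-1.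
  rewrite -{1}(root r r0) ge0_ler_powR ?nnegrE ?ur//.
  exact: le_trans rk (ur k k0).
have up : u k `^ k%:R^-1 <= r + e.
  rewrite -[leRHS]root ?(ltW re)// ge0_ler_powR ?nnegrE ?exprn_ge0 ?(ltW re)//.
    exact: le_trans rk (ur k k0).
  rewrite (le_trans (hK k))//.
  have := hN k Nk; rewrite /= sub0r normrN => /ltW /(le_trans (ler_norm _)).
  rewrite expr_div_n ler_pdivrMr ?exprn_gt0// ler_pdivlMl//.
by rewrite ler0_norm ?subr_le0//; lra.
Qed.

Theorem theorem2p2 (R : realType) (H : hilbertType R)
    (H_neq0 : exists x : H, x != 0)
    (lambda : R) (lambda01 : 0 <= lambda <= 1) (T : bop H) (n : nat) :
  opnorm (iter n (aluthge lambda) (T ^+ k)) `^ (k%:R^-1) @[k --> \oo]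
    --> spectral_radius T /\
  opnorm (aluthge lambda (T ^+ k)) `^ (k%:R^-1) @[k --> \oo]
    --> spectral_radius T.
Proof.
rewrite spectral_radiusE//.
suff cv m : opnorm (iter m (aluthge lambda) (T ^+ k)) `^ (k%:R^-1) @[k --> \oo]
    --> gelfand_radius T by split; [exact: cv | exact: (cv 1%N)].
apply: root_cvg => [|k k0|a Ta]; first exact: gelfand_radius_ge0.
  have /andP[+ _] := iter_aluthge H_neq0 m (T ^+ k) lambda01.
  by apply: le_trans; exact: gelfand_radiusX.
have [K K0 hK] := gelfand_radius_lt Ta; exists K => // k.
by have /andP[_ /le_trans] := iter_aluthge H_neq0 m (T ^+ k) lambda01; apply.
Qed.
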